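(* Assume that $\sup_{\lambda\in\Lambda}\|f-f_\lambda\|_\infty\le L<\infty$, where $\|\cdot\|_\infty$ is the supremum norm on $\mathcal X$, and that the errors $\xi_i$ are symmetric, i.e. $P(\xi_i>a)=P(\xi_i<-a)$ for all $a\in\mathbb R$, with $E(|\xi_i|^s)\le B$ for some constants $s\ge2$, $B>0$. Then for any $\alpha_0>0$ and any $\beta\ge4(1+1/n)\alpha_0n^{2/(s+2)}+2L^2$ the aggregate $\hat f_n$ satisfies $$E\big(\|\hat f_n-f\|_n^2\big)\le\int_\Lambda\|f_\lambda-f\|_n^2\,p(d\lambda)+\frac{\beta\,\mathcal K(p,\pi)}{n+1}+\bar C\,n^{-s/(s+2)}\qquad\text{for all }p\in\mathscr P_\Lambda,$$ where $\bar C>0$ is a constant that depends only on $s,L,B$ and $\alpha_0$.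
   Context: Model: $Y_i=f(x_i)+\xi_i$, $i=1,\dots,n$, where $x_1,\dots,x_n$ are non-random elements of a set $\mathcal X$, $f:\mathcal X\to\mathbb R$ is an unknown function, and $\xi_1,\dots,\xi_n$ are i.i.d. zero-mean real random variables. Write $\mathbf Y=(Y_1,\dots,Y_n)$. $(\Lambda,\mathcal A)$ is a measurable space, $\mathscr P_\Lambda$ is the set of all probability measures on it, and $\{f_\lambda,\lambda\in\Lambda\}$ is a given family of (non-random) functions $f_\lambda:\mathcal X\to\mathbb R$ such that $\lambda\mapsto f_\lambda(x)$ is measurable for every $x\in\mathcal X$. Norms: for functions $g,h$ on $\mathcal X$, $\|g-h\|_n^2=\frac1n\sum_{i=1}^n(g(x_i)-h(x_i))^2$; for $\mathbf y\in\mathbb R^n$, $\|\mathbf y-f_\lambda\|_n^2=\frac1n\sum_{i=1}^n(y_i-f_\lambda(x_i))^2$. For a prior $\pi\in\mathscr P_\Lambda$ and $\beta>0$, the exponentially weighted aggregate is $$\hat f_n(x)=\int_\Lambda\theta_\lambda(\mathbf Y)f_\lambda(x)\,\pi(d\lambda),\qquad \theta_\lambda(\mathbf y)=\frac{\exp\{-n\|\mathbf y-f_\lambda\|_n^2/\beta\}}{\int_\Lambda\exp\{-n\|\mathbf y-f_w\|_n^2/\beta\}\,\pi(dw)}.$$ $\mathcal K(p,\pi)$ is the Kullback–Leibler divergence, $\mathcal K(p,\pi)=\int\log\frac{dp}{d\pi}\,dp$ if $p\ll\pi$ and $+\infty$ otherwise. *)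

(* Defs.v *)
(* MathComp-Analysis development. *)
From mathcomp Require Import all_boot all_order all_algebra.
From mathcomp Require Import all_classical all_reals all_analysis.

Set Implicit Arguments.
Unset Strict Implicit.
Unset Printing Implicit Defensive.

Import Order.TTheory GRing.Theory Num.Theory.
Import numFieldNormedType.Exports.

Local Open Scope classical_set_scope.
Local Open Scope ring_scope.

Section Probability.
Context {R : realType} {d : measure_display} {Omega : measurableType d}.
Variable P : probability Omega R.

Definition mutually_independent (n : nat) (xi : 'I_n -> {RV P >-> R}) : Prop :=
  forall (J : {set 'I_n}) (B : 'I_n -> set R),
    (forall i, measurable (B i)) ->
    (P (\bigcap_(i in [set` J]) (xi i @^-1` B i)) =
     \prod_(i in J) P (xi i @^-1` B i))%E.

Definition identically_distributed (n : nat) (xi : 'I_n -> {RV P >-> R}) : Prop :=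
  forall i j (B : set R), measurable B ->
    distribution P (xi i) B = distribution P (xi j) B.

Definition symmetric_rv (X : {RV P >-> R}) : Prop :=
  forall a : R, P [set w | a < X w] = P [set w | X w < - a].

End Probability.

(* Valued in \bar R: it is +oo when g is unbounded. *)
Definition sup_norm {R : realType} {X : Type} (g : X -> R) : \bar R :=
  ereal_sup [set `|g t|%:E | t in [set: X]].

(* The squared empirical norm of a vector u in R^n; ||g - h||_n^2 is
   obtained at u_i = g (x_i) - h (x_i), and ||y - g||_n^2 at
   u_i = y_i - g (x_i). *)
Definition sqnorm {R : realType} {n : nat} (u : 'I_n -> R) : R :=
  n%:R^-1 * \sum_(i < n) u i ^+ 2.

Definition sqdist {R : realType} {n : nat} {X : Type} (x : 'I_n -> X)
    (g h : X -> R) : R :=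
  sqnorm (fun i => g (x i) - h (x i)).

(* Valued in \bar R.  The Radon-Nikodym derivative is nonnegative up to a
   pi-null (hence p-null) set, where the value -oo of lne is immaterial. *)
Definition KL {R : realType} {d : measure_display} {L : measurableType d}
    (p pi : probability L R) : \bar R :=
  if pselect (p `<< pi) then
    (\int[p]_l lne (Radon_Nikodym (charge_of_finite_measure p) pi l))%E
  else +oo%E.

Section Aggregate.
Context {R : realType} {d : measure_display} {Lam : measurableType d}.
Context {X : Type} {n : nat}.
Variables (x : 'I_n -> X) (F : Lam -> X -> R).
Variables (pi : probability Lam R) (beta : R).

Definition gibbs (y : 'I_n -> R) (l : Lam) : R :=
  expR (- (n%:R * sqnorm (fun i => y i - F l (x i)) / beta)).

Definition theta (y : 'I_n -> R) (l : Lam) : R :=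
  gibbs y l / Rintegral pi setT (gibbs y).

Definition ewa (y : 'I_n -> R) (t : X) : R :=
  Rintegral pi setT (fun l => theta y l * F l t).

End Aggregate.

(* Main.v *)
Require Import Defs.
From mathcomp Require Import all_boot all_order all_algebra.
From mathcomp Require Import all_classical all_reals all_analysis.
From mathcomp Require Import measurable_realfun ring lra.

Set Implicit Arguments.
Unset Strict Implicit.
Unset Printing Implicit Defensive.

Import Order.TTheory GRing.Theory Num.Theory.
Import numFieldNormedType.Exports.

Local Open Scope classical_set_scope.
Local Open Scope ring_scope.

(** Put [g_l = f - f_l], let [w(xi, l)] be the logarithm of the unnormalized
posterior density, [Z = int exp(w(xi, l)) pi(dl)] its normalizing constant and
[G(xi) = ln int exp((1 + 1/n) w(xi, l)) pi(dl)].  Choose random [zeta] with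
[xi + zeta] distributed as [(1 + 1/n) xi]: by symmetry, [zeta] may flip the sign of
[xi] with probability [1 / (2n + 2)].  Then the expectation of [|f_hat - f|^2] is at
most [beta (E ln Z - E G(xi))], up to [beta] times the logarithm of a posterior mean
of [exp (quadratic form in g_l - (f - f_hat))].  That exponential is concave when
[beta] is large, so its tangent at the posterior mean makes this logarithm at most
a tail term.  Jensen and Donsker-Varadhan bound [E ln Z - E G(xi)] by the
Kullback-Leibler term and the risk under [p].

The inequality [x + log (1 + (exp (- a x) - 1) / a) <= a x^2 / 2], usual for this
two-point [zeta], can fail for [x < 0] (take [a = 100, x = -1/50]).  Here
[a x^2] is used instead, for [|a x| <= 1/4] only.  Noise coordinates
with [64 (L + 1) |xi_i| > beta] are outliers and are never flipped; their
[zeta_i = xi_i / n] is not centered, which costs [2 L |xi_i| / n].  Inliers with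
[2 xi_i^2 > alpha0 n^(2/(s+2))] are taken out of the concavity step, and the
[s]-th moment pays for both exceptional cases. *)

(** * Exponential inequalities *)

Lemma nonneg_derive_ge0 (R : realType) (f g : R -> R) (x : R) :
  (forall y, is_derive y (1 : R) f (g y)) -> (forall y, 0 <= y -> 0 <= g y) ->
  0 <= x -> f 0 <= f x.
Proof.
move=> fg g0 x0; rewrite -subr_ge0.
have cf : {within `[0, x], continuous f}.
  by apply: derivable_within_continuous => y _; exact: @ex_derive.
have [c /itvP cx ->] := MVT_segment x0 (fun y _ => fg y) cf.
by rewrite mulr_ge0 ?subr_ge0 ?g0 ?cx.
Qed.

Lemma expR_ge_quadratic (R : realType) (y : R) :
  0 <= y -> 1 + y + y ^+ 2 / 2 <= expR y.
Proof.
move=> y0; rewrite -subr_ge0.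
have := @nonneg_derive_ge0 R (fun x => expR x - (1 + x + x ^+ 2 / 2))
  (fun x => expR x - (1 + x)) y.
rewrite expR0 expr0n /= mul0r !addr0 subrr; apply=> //.
- move=> x; apply: is_derive_eq; rewrite /GRing.scale /=; by field.
- by move=> x _; rewrite subr_ge0 expR_ge1Dx.
Qed.

(** The quotient [(1 + x) * expR (x ^+ 2 / 2 - x)] of the two sides equals 1 at 0 and has derivative
    [x ^+ 2 * expR (x ^+ 2 / 2 - x)]. *)
Lemma expR_le_1Dx (R : realType) (r : R) :
  0 <= r -> expR (r - r ^+ 2 / 2) <= 1 + r.
Proof.
move=> r0.
have := @nonneg_derive_ge0 R (fun x => (1 + x) * expR (x ^+ 2 / 2 - x))
  (fun x => x ^+ 2 * expR (x ^+ 2 / 2 - x)) r.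
rewrite expr0n /= mul0r subrr addr0 expR0 mulr1.
have -> : r ^+ 2 / 2 - r = - (r - r ^+ 2 / 2) by rewrite opprB.
rewrite expRN ler_pdivlMr ?expR_gt0// mul1r; apply => //.
- move=> x; apply: is_derive_eq; rewrite /GRing.scale /=; by field.
- by move=> x _; rewrite mulr_ge0 ?sqr_ge0 ?expR_ge0.
Qed.

(** Squaring [expR (y / 2) <= (1 - y / 2)^-1] reduces this to the polynomial inequality
    [1 <= (1 + y + y ^+ 2) * (1 - y / 2) ^+ 2]. *)
Lemma expR_le_quadratic (R : realType) (y : R) :
  `|y| <= 4^-1 -> expR y <= 1 + y + y ^+ 2.
Proof.
rewrite ler_norml => /andP[y1 y2].
have h : 0 < 1 - y / 2 by lra.
have : expR (y / 2) <= (1 - y / 2)^-1.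
  rewrite -[y / 2]opprK expRN opprK lef_pV2 ?posrE ?expR_gt0 //.
  exact: expR_ge1Dx.
move=> /(lerXn2r 2); rewrite !nnegrE expR_ge0 invr_ge0 (ltW h) => /(_ isT isT).
rewrite -expRM_natl mulrC divfK// => /le_trans; apply.
rewrite exprVn -[leLHS]mul1r ler_pdivrMr ?exprn_gt0//.
nra.
Qed.

(** On the segment [0 <= s <= 1], the function [expR (- (2 * p * s + q * s ^+ 2))] is concave where
    [2 * (p + q * s) ^+ 2 <= q]. The hypotheses are this condition at the two ends, and the
    conclusion compares the value at 1 with the tangent at 0. The proof is direct, by the sign of
    [p]. *)
Lemma expR_le_tangent (R : realType) (p q : R) :
  2 * p ^+ 2 <= q -> 2 * (p + q) ^+ 2 <= q -> expR (- (2 * p + q)) <= 1 - 2 * p.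
Proof.
move=> pq1 pq2; have q0 : 0 <= q by apply: le_trans pq1; rewrite mulr_ge0 ?sqr_ge0.
have [p0|p0] := leP p 0.
  have := @expR_le_1Dx R (- (2 * p)); rewrite oppr_ge0 pmulr_rle0// => /(_ p0).
  apply: le_trans; rewrite ler_expR; nra.
(* If [p + q] exceeded 1/2, then [2 * (p + q) ^+ 2] would exceed [p + q], which exceeds [q]. *)
have pqh : p + q <= 2^-1.
  by apply: contraT; rewrite -ltNge => H; nra.
have y0 : 0 <= 2 * p + q by lra.
have h : 0 < 1 - 2 * p by nra.
rewrite expRN -[leLHS]mul1r ler_pdivrMr ?expR_gt0//.
apply: (@le_trans _ _ ((1 - 2 * p) * (1 + (2 * p + q) + (2 * p + q) ^+ 2 / 2))); last first.
  by rewrite ler_pM2l// expR_ge_quadratic.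
have qh : q <= 2^-1 by lra.
have ph : p <= 2^-1 by lra.
have e1 : p * (2 * p ^+ 2) <= p * q by rewrite ler_pM2l.
have e2 : (p * q) * p <= (p * q) * 2^-1 by rewrite ler_wpM2l// mulr_ge0// ltW.
have e3 : q ^+ 2 * p <= q ^+ 2 * 2^-1 by rewrite ler_wpM2l// sqr_ge0.
nra.
Qed.

(** * Bounded measurable functions *)

Section BoundedMeasurable.
Context {R : realType} {d : measure_display} {T : measurableType d}.
Variable mu : probability T R.
Implicit Types f h : T -> R.

(** This class is closed under the algebraic operations and the exponential, and its members are
    integrable for every probability, so linearity of the integral applies freely to all functions
    of the parameter. *)
Definition bounded_measurable f :=
  measurable_fun setT f /\ exists M : R, forall t, `|f t| <= M.

Lemma bounded_measurable_integrable f :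
  bounded_measurable f -> mu.-integrable setT (EFin \o f).
Proof.
move=> [mf [M fM]]; apply: measurable_bounded_integrable => //.
  by apply: fin_num_fun_lty; exact: fin_num_measure.
exists M; split; first exact: num_real.
by move=> N /ltW MN t _; apply: le_trans MN.
Qed.

Lemma bounded_measurable_cst (r : R) : bounded_measurable (fun=> r).
Proof. by split=> //; exists `|r|. Qed.

Lemma bounded_measurableD f h : bounded_measurable f -> bounded_measurable h ->
  bounded_measurable (fun t => f t + h t).
Proof.
move=> [mf [M fM]] [mh [N hN]]; split; first exact: measurable_funD.
by exists (M + N) => t; apply: le_trans (ler_normD _ _) _; apply: lerD.
Qed.

Lemma bounded_measurableM f h : bounded_measurable f -> bounded_measurable h ->
  bounded_measurable (fun t => f t * h t).
Proof.
move=> [mf [M fM]] [mh [N hN]]; split; first exact: measurable_funM.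
by exists (M * N) => t; rewrite normrM ler_pM.
Qed.

Lemma bounded_measurableZ (r : R) f : bounded_measurable f ->
  bounded_measurable (fun t => r * f t).
Proof. by apply: bounded_measurableM; exact: bounded_measurable_cst. Qed.

Lemma bounded_measurableN f : bounded_measurable f ->
  bounded_measurable (fun t => - f t).
Proof.
by move=> /(bounded_measurableZ (-1)); under eq_fun do rewrite mulN1r.
Qed.

Lemma bounded_measurableX f k : bounded_measurable f ->
  bounded_measurable (fun t => f t ^+ k).
Proof.
move=> bf; elim: k => [|k IH].
  by under eq_fun do rewrite expr0; exact: bounded_measurable_cst.
by under eq_fun do rewrite exprS; exact: bounded_measurableM.
Qed.

Lemma bounded_measurable_sum (I : Type) (r : seq I) (F : I -> T -> R) :
  (forall i, bounded_measurable (F i)) ->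
  bounded_measurable (fun t => \sum_(i <- r) F i t).
Proof.
move=> bF; elim: r => [|i r IH].
  by under eq_fun do rewrite big_nil; exact: bounded_measurable_cst.
by under eq_fun do rewrite big_cons; exact: bounded_measurableD.
Qed.

Lemma bounded_measurable_expR f : bounded_measurable f ->
  bounded_measurable (fun t => expR (f t)).
Proof.
move=> [mf [M fM]]; split; first exact: measurableT_comp.
exists (expR M) => t; rewrite ger0_norm ?expR_ge0// ler_expR.
by apply: le_trans (fM t); exact: ler_norm.
Qed.

Lemma Rintegral_bD f h : bounded_measurable f -> bounded_measurable h ->
  (\int[mu]_t (f t + h t) = \int[mu]_t f t + \int[mu]_t h t)%R.
Proof. by move=> bf bh; rewrite RintegralD//; exact: bounded_measurable_integrable. Qed.

Lemma Rintegral_bZ (r : R) f : bounded_measurable f ->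
  (\int[mu]_t (r * f t) = r * \int[mu]_t f t)%R.
Proof. by move=> bf; rewrite RintegralZl//; exact: bounded_measurable_integrable. Qed.

Lemma Rintegral_bsum (I : Type) (r : seq I) (F : I -> T -> R) :
  (forall i, bounded_measurable (F i)) ->
  (\int[mu]_t (\sum_(i <- r) F i t) = \sum_(i <- r) \int[mu]_t F i t)%R.
Proof.
move=> bF; elim: r => [|i r IH].
  under eq_Rintegral do rewrite big_nil.
  by rewrite big_nil Rintegral_cst// mul0r.
under eq_Rintegral do rewrite big_cons.
by rewrite big_cons Rintegral_bD ?IH//; exact: bounded_measurable_sum.
Qed.

Lemma Rintegral_prob_cst (r : R) : (\int[mu]_t r)%R = r.
Proof. by rewrite Rintegral_cst//= probability_setT mulr1. Qed.

Lemma le_Rintegral_b f h : bounded_measurable f -> bounded_measurable h ->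
  (forall t, f t <= h t) -> (\int[mu]_t f t <= \int[mu]_t h t)%R.
Proof.
by move=> bf bh fh; apply: le_Rintegral => //; exact: bounded_measurable_integrable.
Qed.

Lemma Rintegral_ge_lb f (r : R) : bounded_measurable f -> (forall t, r <= f t) ->
  r <= (\int[mu]_t f t)%R.
Proof.
move=> bf rf; rewrite -[leLHS]Rintegral_prob_cst.
exact: (le_Rintegral_b (bounded_measurable_cst r)).
Qed.

Lemma Rintegral_le_ub f (r : R) : bounded_measurable f -> (forall t, f t <= r) ->
  (\int[mu]_t f t)%R <= r.
Proof.
move=> bf rf; rewrite -[leRHS]Rintegral_prob_cst.
exact: (le_Rintegral_b bf (bounded_measurable_cst r)).
Qed.

Lemma Rintegral_expR_gt0 f : bounded_measurable f ->
  0 < (\int[mu]_t expR (f t))%R.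
Proof.
move=> [mf [M fM]]; apply: (@lt_le_trans _ _ (expR (- M))); first exact: expR_gt0.
apply: Rintegral_ge_lb; first by apply: bounded_measurable_expR; split; last exists M.
by move=> t; rewrite ler_expR; have /ler_normlP[] := fM t; rewrite lerNl.
Qed.

(* Jensen's inequality for the concave power [k <= 1]. *)
Lemma ln_Rintegral_expR_scale f (k : R) : 0 <= k <= 1 -> bounded_measurable f ->
  ln (\int[mu]_t expR (k * f t)) <= k * ln (\int[mu]_t expR (f t)).
Proof.
move=> /andP[k0 k1] bf; have I0 := Rintegral_expR_gt0 bf.
set C := Rintegral _ _ _ in I0 *.
rewrite -ler_expR lnK; last by rewrite posrE; apply/Rintegral_expR_gt0/bounded_measurableZ.
(* Convexity of the exponential between [y = f t - ln C] and 0 bounds [expR (k * y)] by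
   [k * expR y + (1 - k)], whose mean is 1 by the choice of [C]. *)
apply: (@le_trans _ _ (\int[mu]_t (expR (k * ln C) *
    (k * (C^-1 * expR (f t)) + (1 - k))))%R).
  apply: le_Rintegral_b.
  - exact/bounded_measurable_expR/bounded_measurableZ.
  - apply/bounded_measurableZ/bounded_measurableD/bounded_measurable_cst.
    exact/bounded_measurableZ/bounded_measurableZ/bounded_measurable_expR.
  - move=> t; set y := f t - ln C.
    have -> : C^-1 * expR (f t) = expR y by rewrite /y expRB lnK// mulrC.
    have -> : k * f t = k * ln C + k * y by rewrite /y; ring.
    rewrite expRD ler_pM2l ?expR_gt0//.
    have /(_ y 0) := @convex_expR R (Itv01 k0 k1).
    by rewrite !convRE /= expR0 mulr0 addr0 mulr1.

rewrite Rintegral_bZ; last first.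
  apply/bounded_measurableD/bounded_measurable_cst.
  exact/bounded_measurableZ/bounded_measurableZ/bounded_measurable_expR.
rewrite Rintegral_bD; [|exact/bounded_measurableZ/bounded_measurableZ/bounded_measurable_expR
  |exact: bounded_measurable_cst].
rewrite Rintegral_bZ; last exact/bounded_measurableZ/bounded_measurable_expR.
rewrite Rintegral_bZ; last exact/bounded_measurable_expR.
by rewrite Rintegral_prob_cst -/C mulVf ?gt_eqF// mulr1 addrC subrK mulr1.
Qed.

End BoundedMeasurable.

(** * The exponential moment of the perturbation and the concavity step *)

(** Cauchy-Schwarz against the constant vector, read off from the nonnegativity of the sum of
    squared deviations from the mean. *)
Lemma sqr_sum_le (R : realType) (n : nat) (z : 'I_n -> R) :
  (\sum_i z i) ^+ 2 <= n%:R * \sum_i z i ^+ 2.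
Proof.
case: n z => [|n] z; first by rewrite !big_ord0 expr0n mul0r.
set S := \sum_i z i; have n0 : 0 < n.+1%:R :> R by rewrite ltr0n.
have : 0 <= \sum_i (z i - S / n.+1%:R) ^+ 2 by apply: sumr_ge0 => i _; exact: sqr_ge0.
have -> : \sum_i (z i - S / n.+1%:R) ^+ 2 =
    \sum_i z i ^+ 2 - S ^+ 2 / n.+1%:R.
  under eq_bigr do rewrite sqrrB.
  rewrite big_split /= sumrB.
  have -> : \sum_(i < n.+1) z i * (S / n.+1%:R) *+ 2 = S ^+ 2 / n.+1%:R *+ 2.
    by rewrite sumrMnl -mulr_suml mulrA -expr2.
  rewrite sumr_const card_ord -[X in _ + X]mulr_natr.
  by field; rewrite gt_eqF.
by rewrite subr_ge0 ler_pdivrMr// mulrC.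
Qed.

Lemma sum_ffun_prod1 (R : comPzRingType) (I J : finType) (p : J -> R) :
  \sum_j p j = 1 -> \sum_(e : {ffun I -> J}) \prod_i p (e i) = 1.
Proof. by move=> p1; rewrite -(bigA_distr_bigA (fun=> p)) big1. Qed.

Lemma sum_ffun_prod_mean0 (R : comPzRingType) (I J : finType) (p : J -> R)
    (h : I -> J -> R) : (forall i, \sum_j p j * h i j = 0) ->
  \sum_(e : {ffun I -> J}) (\prod_i p (e i)) * \sum_i h i (e i) = 0.
Proof.
move=> ph0; under eq_bigr do rewrite mulr_sumr.
rewrite exchange_big /= big1// => i _.
(* Placing [h i] in the factor of coordinate [i] alone lets the sum distribute into a product in
   which that factor vanishes. *)
transitivity (\sum_(e : {ffun I -> J})
    \prod_k (p (e k) * (if k == i then h k (e k) else 1))).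
  apply: eq_bigr => e _; rewrite big_split /=; congr (_ * _).
  by rewrite -big_mkcond /= big_pred1_eq.
rewrite -(bigA_distr_bigA (fun k j => p j * (if k == i then h k j else 1))).
by rewrite (bigD1 i)//= eqxx ph0 mul0r.
Qed.

(** * The squared posterior mean for a fixed noise vector *)

Section PosteriorBound.
Context {R : realType} {d : measure_display} {Lam : measurableType d}.
Variables (pi : probability Lam R) (n : nat) (g : Lam -> 'I_n -> R).
Variables (L beta : R).
Hypotheses (n0 : (0 < n)%N) (beta0 : 0 < beta) (L0 : 0 <= L).
Hypothesis mg : forall i, measurable_fun setT (fun l => g l i).
Hypothesis gL : forall l i, `|g l i| <= L.

Local Notation N := (n%:R : R).

Let N0 : 0 < N. Proof. by rewrite ltr0n. Qed.
Let N1 : 1 <= N. Proof. by rewrite ler1n. Qed.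
Let NV1 : N^-1 <= 1. Proof. by rewrite invf_le1. Qed.
Let NV0 : 0 < N^-1. Proof. by rewrite invr_gt0. Qed.

Lemma bounded_measurable_g i : bounded_measurable (fun l => g l i).
Proof. by split=> //; exists L => l. Qed.

(** With [g l] the error of the function indexed by [l] at the design points and [u] the noise, this
    is the Gibbs exponent without its part in [u i ^+ 2], which does not depend on [l]. *)
Definition logw (u : 'I_n -> R) (l : Lam) : R :=
  - (\sum_i (g l i ^+ 2 + 2 * u i * g l i)) / beta.

Lemma bounded_measurable_logw u : bounded_measurable (logw u).
Proof.
apply: bounded_measurableM; last exact: bounded_measurable_cst.
apply/bounded_measurableN/bounded_measurable_sum => i.
apply: bounded_measurableD; first exact/bounded_measurableX/bounded_measurable_g.
exact/bounded_measurableZ/bounded_measurable_g.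
Qed.

(** The constant 64 brings the exponents of [shift_mgf_le] below 1/4, and [L + 1] keeps the
    threshold [beta / (64 * (L + 1))] meaningful when [L] is 0. *)
Definition inlier (t : R) : bool := 64 * (L + 1) * `|t| <= beta.

Definition flip (b : bool) (t : R) : R := if b && inlier t then - t else t.

(** The flip probability [r] solves [(1 + N^-1) * (1 - 2 * r) = 1], which centers the shift. *)
Definition flip_prob (b : bool) : R :=
  if b then (2 * N + 2)^-1 else 1 - (2 * N + 2)^-1.

(* Given [xi = t], the perturbation [zeta] is [shift b t] with probability
   [flip_prob b]; it makes [xi + zeta] equal to [(1 + 1/n)] times a copy of [xi]
   and is centered when [t] is an inlier. *)
Definition shift (b : bool) (t : R) : R := (1 + N^-1) * flip b t - t.

(** This variant multiplies the posterior mean, where the linear term has to average out for every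
    [t]; outliers therefore contribute 0. *)
Definition centered_shift (b : bool) (t : R) : R :=
  if inlier t then shift b t else 0.

Definition curv (t : R) : R := 8 * (1 + N^-1) * t ^+ 2 / beta.

Lemma flip_prob_ge0 b : 0 <= flip_prob b.
Proof.
have h : 0 < 2 * N + 2 by rewrite addr_gt0// mulr_gt0.
by case: b; rewrite /flip_prob ?invr_ge0 ?(ltW h)// subr_ge0 invf_le1//; have := N1; lra.
Qed.

Lemma flip_prob_sum : \sum_b flip_prob b = 1.
Proof. by rewrite big_bool /= /flip_prob addrC subrK. Qed.

Lemma centered_shift_mean t : \sum_b flip_prob b * centered_shift b t = 0.
Proof.
rewrite big_bool /= /centered_shift /shift /flip /flip_prob /=.
case: (inlier t); last by rewrite !mulr0 addr0.
field; apply/andP; split; rewrite gt_eqF//; have := N0; lra.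
Qed.

(** With [A = 2 * N + 2], the exponent is [x] without flip and [x - A * x] with flip. The quadratic
    bound on [expR (- (A * x))] makes the average at most [expR x * (1 - x + A * x ^+ 2)], and
    [1 + z <= expR z] cancels the linear term. *)
Lemma shift_mgf_le t D : inlier t -> `|D| <= 2 * L ->
  \sum_b flip_prob b * expR (- (2 * (shift b t * D)) / beta) <=
  expR (curv t * D ^+ 2 / (N * beta)).
Proof.
move=> int DL; rewrite big_bool /= /shift /flip /flip_prob /= int.
set A := 2 * N + 2; have A0 : 0 < A by rewrite addr_gt0// mulr_gt0.
set x := - (2 * (t * D)) / (N * beta).
have -> : - (2 * (((1 + N^-1) * - t - t) * D)) / beta = x - A * x.
  by rewrite /x /A; field; rewrite !gt_eqF.
have -> : - (2 * (((1 + N^-1) * t - t) * D)) / beta = x.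
  by rewrite /x; field; rewrite !gt_eqF.
have -> : curv t * D ^+ 2 / (N * beta) = A * x ^+ 2.
  by rewrite /curv /x /A; field; rewrite !gt_eqF.
have y4 : `|- (A * x)| <= 4^-1.
  have -> : - (A * x) = 4 * (1 + N^-1) * (t * D) / beta.
    by rewrite /x /A; field; rewrite !gt_eqF.
  rewrite normrM normfV (gtr0_norm beta0) ler_pdivrMr//.
  rewrite normrM [`|4 * _|]ger0_norm ?mulr_ge0 ?addr_ge0 ?(ltW NV0)//.
  rewrite normrM.
  have h1 : `|t| * `|D| <= `|t| * (2 * L) by rewrite ler_wpM2l.
  have h2 : (1 + N^-1) * (`|t| * `|D|) <= 2 * (`|t| * (2 * L)).
    by rewrite ler_pM ?addr_ge0 ?mulr_ge0 ?(ltW NV0)//; have := NV1; lra.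
  move: int; rewrite /inlier.
  have : 0 <= `|t| by [].
  have : 0 <= L * `|t| by rewrite mulr_ge0.
  nra.
rewrite expRD.
have := expR_le_quadratic y4; set E := expR (- (A * x)) => Eq.
have -> : A^-1 * (expR x * E) + (1 - A^-1) * expR x = expR x * (1 + (E - 1) / A).
  by field; rewrite gt_eqF.
have -> : A * x ^+ 2 = x + (A * x ^+ 2 - x) by ring.
rewrite expRD ler_pM2l ?expR_gt0//.
apply: le_trans (expR_ge1Dx _).
rewrite lerD2l ler_pdivrMr//; nra.
Qed.

Variables (thr : R) (rest : R -> R).
Hypothesis rest_ge0 : forall t, 0 <= rest t.
Hypothesis rest_inlier : forall t, inlier t -> thr < 2 * t ^+ 2 ->
  4 * L ^+ 2 * curv t <= rest t.
Hypothesis rest_outlier : forall t, ~~ inlier t -> 2 * L * `|t| <= rest t.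

(** Only coefficients with a uniform bound enter the concavity step. Larger inliers are charged to
    [rest] by [rest_inlier], and outliers by [rest_outlier]. *)
Definition trunc_curv (t : R) : R :=
  if inlier t && (2 * t ^+ 2 <= thr) then curv t else 0.

Lemma curv_ge0 t : 0 <= curv t.
Proof.
by rewrite divr_ge0 ?(ltW beta0)// mulr_ge0 ?sqr_ge0// mulr_ge0// addr_ge0// ltW.
Qed.

Lemma trunc_curv_ge0 t : 0 <= trunc_curv t.
Proof. by rewrite /trunc_curv; case: ifP => // _; exact: curv_ge0. Qed.

Lemma trunc_curv_le t : 0 <= thr -> trunc_curv t <= 4 * (1 + N^-1) * thr / beta.
Proof.
move=> thr0; rewrite /trunc_curv; case: ifP => [/andP[_ h]|_]; last first.
  by rewrite divr_ge0 ?(ltW beta0)// mulr_ge0// mulr_ge0// addr_ge0// ltW.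
rewrite /curv ler_pM2r ?invr_gt0//.
have -> : 8 * (1 + N^-1) * t ^+ 2 = 4 * (1 + N^-1) * (2 * t ^+ 2) by ring.
by rewrite ler_pM2l// mulr_gt0// addr_gt0.
Qed.

(** An inlier below the threshold keeps its quadratic term. Above the threshold,
    [(x - a) ^+ 2 <= 4 * L ^+ 2] turns that term into a part of [rest]. For an outlier both shifts
    equal [t / N], so the exponent is at most [2 * L * |t| / (N * beta)]. *)
Lemma coordinate_mgf_le t x a : `|x| <= L -> `|a| <= L ->
  \sum_b flip_prob b *
    expR (- (2 * (shift b t * x - centered_shift b t * a)) / beta) <=
  expR ((trunc_curv t * (x - a) ^+ 2 + rest t) / (N * beta)).
Proof.
move=> xL aL; have [int|outt] := boolP (inlier t).
  have DL : `|x - a| <= 2 * L.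
    by apply: le_trans (ler_normB _ _) _; rewrite mulr2n mulrDl mul1r lerD.
  under eq_bigr do rewrite /centered_shift int -mulrBr.
  apply: le_trans (shift_mgf_le int DL) _; rewrite ler_expR.
  rewrite ler_pM2r ?invr_gt0 ?mulr_gt0// /trunc_curv int /=.
  case: (leP (2 * t ^+ 2) thr) => [_|h]; first by rewrite lerDl.
  rewrite mul0r add0r; apply: le_trans (rest_inlier int h).
  rewrite mulrC ler_wpM2r ?curv_ge0//.
  have -> : 4 * L ^+ 2 = (2 * L) ^+ 2 by ring.
  by rewrite -[leLHS]real_normK ?num_real// lerXn2r ?nnegrE// mulr_ge0.
have E b : expR (- (2 * (shift b t * x - centered_shift b t * a)) / beta) =
    expR (- (2 * t * x) / (N * beta)).
  rewrite /centered_shift /shift /flip (negbTE outt) andbF mul0r subr0.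
  by congr expR; field; rewrite !gt_eqF.
under eq_bigr do rewrite E.
rewrite -mulr_suml flip_prob_sum mul1r ler_expR ler_pM2r ?invr_gt0 ?mulr_gt0//.
rewrite /trunc_curv (negbTE outt) /= mul0r add0r.
apply: le_trans (rest_outlier outt).
apply: le_trans (ler_norm _) _; rewrite normrN !normrM ger0_norm//.
have : `|t| * `|x| <= `|t| * L by rewrite ler_wpM2l.
nra.
Qed.

Lemma ge0_bounded_measurable_mean_le (theta h : Lam -> R) :
  bounded_measurable theta -> (forall l, 0 <= theta l) ->
  (\int[pi]_l theta l = 1)%R -> bounded_measurable h -> (forall l, `|h l| <= L) ->
  `|(\int[pi]_l (theta l * h l))%R| <= L.
Proof.
move=> bt t0 t1 bh hL; rewrite ler_norml -{1}[L]mulr1 -{2}[L]mulr1 -t1 -mulNr.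
rewrite -!Rintegral_bZ//.
apply/andP; split; apply: le_Rintegral_b; try exact: bounded_measurableM;
  try exact: bounded_measurableZ.
  move=> l; rewrite mulrC ler_wpM2l//.
  by have := hL l; rewrite ler_norml => /andP[].
move=> l; rewrite mulrC ler_wpM2r//.
by have := hL l; rewrite ler_norml => /andP[].
Qed.

(** The exponential lies below its tangent at [a], and the linear part of the tangent has posterior
    mean 0 because [a] is the posterior mean of [g]. The lower bound on [beta] supplies the
    concavity, with [cb] the part of the curvature spent on the noise. *)
Lemma expR_concave_mean_le1 (theta : Lam -> R) (a c : 'I_n -> R) (cb : R) :
  bounded_measurable theta -> (forall l, 0 <= theta l) ->
  (\int[pi]_l theta l = 1)%R ->
  (forall i, a i = (\int[pi]_l (theta l * g l i))%R) ->
  (forall i, 0 <= c i <= cb) -> 2 * L ^+ 2 <= beta * (1 - cb) ->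
  (\int[pi]_l (theta l *
     expR (- (\sum_i (g l i ^+ 2 - a i ^+ 2 - c i * (g l i - a i) ^+ 2)) /
             (N * beta))) <= 1)%R.
Proof.
move=> bt t0 t1 aE c01 cbL.
have aL i : `|a i| <= L.
  rewrite aE; apply: ge0_bounded_measurable_mean_le => //.
  exact: bounded_measurable_g.
have cb1 : cb <= 1.
  rewrite -subr_ge0 -(pmulr_rge0 _ beta0); apply: le_trans cbL.
  by rewrite mulr_ge0 ?sqr_ge0.
have Nb0 : 0 < N * beta by rewrite mulr_gt0.
(* Expansion around [a]: with [v = g l i - a i], each summand of the exponent is
   [2 * a i * v + (1 - c i) * v ^+ 2]. *)
pose p l := (\sum_i a i * (g l i - a i)) / (N * beta).
pose q l := (\sum_i (1 - c i) * (g l i - a i) ^+ 2) / (N * beta).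
have bp : bounded_measurable p.
  apply: bounded_measurableM; last exact: bounded_measurable_cst.
  apply: bounded_measurable_sum => i; apply/bounded_measurableZ.
  apply: bounded_measurableD; first exact: bounded_measurable_g.
  exact: bounded_measurable_cst.
have bq : bounded_measurable q.
  apply: bounded_measurableM; last exact: bounded_measurable_cst.
  apply: bounded_measurable_sum => i; apply/bounded_measurableZ.
  apply/bounded_measurableX/bounded_measurableD; first exact: bounded_measurable_g.
  exact: bounded_measurable_cst.
have E l : - (\sum_i (g l i ^+ 2 - a i ^+ 2 - c i * (g l i - a i) ^+ 2)) /
    (N * beta) = - (2 * p l + q l).
  rewrite /p /q mulrA -mulrDl mulNr; congr (- (_ / _)).
  rewrite mulr_sumr -big_split /=; apply: eq_bigr => i _; ring.
have pq l : expR (- (2 * p l + q l)) <= 1 - 2 * p l.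
  pose S := \sum_i (g l i - a i) ^+ 2.
  have qS : 2 * L ^+ 2 * S / (N * beta ^+ 2) <= q l.
    have -> : 2 * L ^+ 2 * S / (N * beta ^+ 2) = 2 * L ^+ 2 / beta * S / (N * beta).
      by field; rewrite !gt_eqF.
    rewrite ler_pM2r ?invr_gt0// mulr_sumr; apply: ler_sum => i _.
    rewrite ler_wpM2r ?sqr_ge0// ler_pdivrMr// mulrC.
    rewrite [leRHS]mulrC [leLHS]mulrC; apply: le_trans cbL _; rewrite ler_pM2l//.
    by have /andP[_ ?] := c01 i; rewrite lerB.
  (* By Cauchy-Schwarz, this serves both ends of the segment: [w = a] gives [p l], and the convex
     combination [c i * a i + (1 - c i) * g l i] gives [p l + q l]. *)
  have key (w : 'I_n -> R) : (forall i, `|w i| <= L) ->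
      2 * ((\sum_i w i * (g l i - a i)) / (N * beta)) ^+ 2 <= q l.
    move=> wL; apply: le_trans qS.
    have -> : 2 * ((\sum_i w i * (g l i - a i)) / (N * beta)) ^+ 2 =
      2 * (\sum_i w i * (g l i - a i)) ^+ 2 / (N ^+ 2 * beta ^+ 2).
      by field; rewrite !gt_eqF.
    have -> : 2 * L ^+ 2 * S / (N * beta ^+ 2) =
      2 * (N * (L ^+ 2 * S)) / (N ^+ 2 * beta ^+ 2).
      by field; rewrite !gt_eqF.
    rewrite ler_pM2r ?invr_gt0 ?mulr_gt0 ?exprn_gt0// ler_pM2l//.
    apply: le_trans (sqr_sum_le _) _; rewrite ler_pM2l// mulr_sumr.
    apply: ler_sum => i _; rewrite exprMn ler_wpM2r ?sqr_ge0//.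
    by rewrite -[leLHS]real_normK ?num_real// lerXn2r ?nnegrE.
  apply: expR_le_tangent; first exact: key.
  have -> : p l + q l =
      (\sum_i (a i + (1 - c i) * (g l i - a i)) * (g l i - a i)) / (N * beta).
    rewrite /p /q -mulrDl; congr (_ / _).
    by rewrite -big_split /=; apply: eq_bigr => i _; ring.
  apply: key => i; have /andP[c0 ccb] := c01 i.
  have -> : a i + (1 - c i) * (g l i - a i) = c i * a i + (1 - c i) * g l i by ring.
  apply: le_trans (ler_normD _ _) _; rewrite !normrM ger0_norm//.
  have c1 : 0 <= 1 - c i by rewrite subr_ge0 (le_trans ccb).
  rewrite (ger0_norm c1); have -> : L = c i * L + (1 - c i) * L by ring.
  by rewrite lerD// ler_wpM2l.
under eq_Rintegral do rewrite E.
have b2p : bounded_measurable (fun l => 1 + (- 2) * p l).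
  by apply: bounded_measurableD; [exact: bounded_measurable_cst|exact: bounded_measurableZ].
apply: (@le_trans _ _ (\int[pi]_l (theta l * (1 + (- 2) * p l)))%R).
  apply: le_Rintegral_b.
  - apply/bounded_measurableM/bounded_measurable_expR/bounded_measurableN => //.
    by apply/bounded_measurableD => //; exact: bounded_measurableZ.
  - exact: bounded_measurableM.
  - by move=> l; rewrite ler_wpM2l// mulNr.
have -> : (\int[pi]_l (theta l * (1 + (- 2) * p l)))%R =
    (\int[pi]_l (theta l + \sum_i (- 2 / (N * beta) * a i) *
       (theta l * g l i + - a i * theta l)))%R.
  apply: eq_Rintegral => l _; rewrite mulrDr mulr1; congr (_ + _).
  rewrite /p mulr_suml !mulr_sumr; apply: eq_bigr => i _.
  by field; rewrite !gt_eqF.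
have bi i : bounded_measurable (fun l => theta l * g l i + - a i * theta l).
  apply: bounded_measurableD; last exact: bounded_measurableZ.
  by apply: bounded_measurableM => //; exact: bounded_measurable_g.
rewrite Rintegral_bD//; last first.
  by apply: bounded_measurable_sum => i; exact: bounded_measurableZ.
rewrite Rintegral_bsum; last by move=> i; exact: bounded_measurableZ.
rewrite t1 big1 ?addr0// => i _; rewrite Rintegral_bZ//.
rewrite Rintegral_bD; [|by apply: bounded_measurableM => //; exact: bounded_measurable_g
  |exact: bounded_measurableZ].
by rewrite Rintegral_bZ// t1 -aE mulr1 subrr mulr0.
Qed.

(** Since [(1 + N^-1) * flip] is [u + shift], the scaled weight at the flipped noise is the original
    weight tilted by the shift and by an extra [N^-1] share of the squares. *)
Lemma logw_shift (e : {ffun 'I_n -> bool}) u l :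
  (1 + N^-1) * logw (fun i => flip (e i) (u i)) l =
  logw u l - (N^-1 * \sum_i g l i ^+ 2 +
              2 * \sum_i shift (e i) (u i) * g l i) / beta.
Proof.
rewrite /logw mulrA -mulrBl; congr (_ / _).
rewrite mulrN -opprD !mulr_sumr -!big_split /=.
by congr (- _); apply: eq_bigr => i _; rewrite /shift; ring.
Qed.

(** For each flip pattern [e], the ratio [I e / Z] is a posterior mean of the tilt of [logw_shift].
    Multiplied by [expR (K e)] it becomes [A e], whose average over [e] is at most
    [expR (rho / beta)]. Taking logarithms and averaging leaves the squared norm of [a], which is
    the bulk of [K]. *)
Lemma sqnorm_posterior_mean_le (u a : 'I_n -> R) : 0 <= thr ->
  2 * L ^+ 2 <= beta * (1 - 4 * (1 + N^-1) * thr / beta) ->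
  (forall i, a i =
    (\int[pi]_l (expR (logw u l) / (\int[pi]_k expR (logw u k)) * g l i))%R) ->
  N^-1 * \sum_i a i ^+ 2 <=
  beta * ln (\int[pi]_l expR (logw u l))
  - beta * \sum_(e : {ffun 'I_n -> bool}) (\prod_i flip_prob (e i)) *
      ln (\int[pi]_l expR ((1 + N^-1) * logw (fun i => flip (e i) (u i)) l))
  + N^-1 * \sum_i rest (u i).
Proof.
move=> thr0 thrL aE.
have bw := bounded_measurable_logw u.
have bew := bounded_measurable_expR bw.
set Z := (\int[pi]_l expR (logw u l))%R in aE *.
have Z0 : 0 < Z by exact: Rintegral_expR_gt0.
pose theta l := expR (logw u l) / Z.
have bt : bounded_measurable theta.
  by apply: bounded_measurableM => //; exact: bounded_measurable_cst.
have t0 l : 0 <= theta l by rewrite divr_ge0 ?expR_ge0 ?(ltW Z0).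
have t1 : (\int[pi]_l theta l = 1)%R.
  under eq_Rintegral do rewrite /theta mulrC.
  by rewrite Rintegral_bZ// -/Z mulVf// gt_eqF.
have aL i : `|a i| <= L.
  rewrite aE; apply: ge0_bounded_measurable_mean_le => //.
  exact: bounded_measurable_g.
pose q (e : {ffun 'I_n -> bool}) := \prod_i flip_prob (e i).
have q0 e : 0 <= q e by apply: prodr_ge0 => i _; exact: flip_prob_ge0.
have q1 : \sum_e q e = 1 by exact/sum_ffun_prod1/flip_prob_sum.
pose I (e : {ffun 'I_n -> bool}) :=
  (\int[pi]_l expR ((1 + N^-1) * logw (fun i => flip (e i) (u i)) l))%R.
have I0 e : 0 < I e.
  exact/Rintegral_expR_gt0/bounded_measurableZ/bounded_measurable_logw.
pose rho := N^-1 * \sum_i rest (u i).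
(* The exponent of the tilt with [g] replaced by its posterior mean and the shifts of outliers
   dropped. *)
pose K (e : {ffun 'I_n -> bool}) :=
  (N^-1 * \sum_i a i ^+ 2 + 2 * \sum_i centered_shift (e i) (u i) * a i) / beta.
pose A e := I e / Z * expR (K e).
have A0 e : 0 < A e by rewrite mulr_gt0 ?divr_gt0 ?expR_gt0.
pose base l := - (N^-1 * \sum_i (g l i ^+ 2 - a i ^+ 2)) / beta.
pose cross (e : {ffun 'I_n -> bool}) l := \prod_i
  expR (- (2 * (shift (e i) (u i) * g l i - centered_shift (e i) (u i) * a i)) / beta).
have AE e : A e = (\int[pi]_l (theta l * (expR (base l) * cross e l)))%R.
  have -> : A e = (\int[pi]_l (expR (K e) / Z *
      expR ((1 + N^-1) * logw (fun i => flip (e i) (u i)) l)))%R.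
    rewrite Rintegral_bZ; last first.
      exact/bounded_measurable_expR/bounded_measurableZ/bounded_measurable_logw.
    by rewrite -/(I e) /A; ring.
  apply: eq_Rintegral => l _; rewrite logw_shift /cross -expR_sum.
  rewrite expRD /theta.
  have -> : expR (K e) / Z * (expR (logw u l) *
      expR (- ((N^-1 * \sum_i g l i ^+ 2 +
                2 * \sum_i shift (e i) (u i) * g l i) / beta))) =
      expR (logw u l) / Z * (expR (K e) * expR (- ((N^-1 * \sum_i g l i ^+ 2 +
                2 * \sum_i shift (e i) (u i) * g l i) / beta))) by ring.
  congr (_ * _); rewrite -!expRD; congr expR.
  rewrite /K /base -mulr_suml sumrN -mulr_sumr !sumrB.
  by ring.
have bbase : bounded_measurable base.
  apply: bounded_measurableM; last exact: bounded_measurable_cst.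
  apply/bounded_measurableN/bounded_measurableZ/bounded_measurable_sum => i.
  apply: bounded_measurableD; last exact: bounded_measurable_cst.
  exact/bounded_measurableX/bounded_measurable_g.
have bcross e : bounded_measurable (cross e).
  rewrite /cross; under eq_fun do rewrite -expR_sum.
  apply/bounded_measurable_expR/bounded_measurable_sum => i.
  apply: bounded_measurableM; last exact: bounded_measurable_cst.
  apply/bounded_measurableN/bounded_measurableZ.
  apply: bounded_measurableD; last exact: bounded_measurable_cst.
  exact/bounded_measurableZ/bounded_measurable_g.
have bAE e : bounded_measurable (fun l => theta l * (expR (base l) * cross e l)).
  apply: bounded_measurableM => //; apply: bounded_measurableM => //.
  exact: bounded_measurable_expR.
pose conc l := - (\sum_i (g l i ^+ 2 - a i ^+ 2 -
    trunc_curv (u i) * (g l i - a i) ^+ 2)) / (N * beta).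
have bconc : bounded_measurable conc.
  apply: bounded_measurableM; last exact: bounded_measurable_cst.
  apply/bounded_measurableN/bounded_measurable_sum => i.
  apply: bounded_measurableD.
    apply: bounded_measurableD; last exact: bounded_measurable_cst.
    exact/bounded_measurableX/bounded_measurable_g.
  apply/bounded_measurableN/bounded_measurableZ/bounded_measurableX.
  apply: bounded_measurableD; last exact: bounded_measurable_cst.
  exact: bounded_measurable_g.
have sumA : \sum_e q e * A e <= expR (rho / beta).
  have -> : \sum_e q e * A e = (\int[pi]_l (\sum_e
      q e * (theta l * (expR (base l) * cross e l))))%R.
    rewrite Rintegral_bsum; last by move=> e; exact: bounded_measurableZ.
    by apply: eq_bigr => e _; rewrite AE Rintegral_bZ.
  apply: (@le_trans _ _ (\int[pi]_l (expR (rho / beta) * (theta l * expR (conc l))))%R).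
    apply: le_Rintegral_b.
    - by apply: bounded_measurable_sum => e; exact: bounded_measurableZ.
    - apply/bounded_measurableZ/bounded_measurableM => //.
      exact: bounded_measurable_expR.
    - move=> l.
      have -> : \sum_e q e * (theta l * (expR (base l) * cross e l)) =
          theta l * (expR (base l) * \sum_e q e * cross e l).
        rewrite !mulr_sumr; apply: eq_bigr => e _; ring.
      rewrite [leRHS]mulrCA ler_wpM2l//.
      (* Independence of the flips: the average over patterns becomes a product of two-point
         averages, one per coordinate. *)
      have -> : \sum_e q e * cross e l = \prod_i \sum_b flip_prob b *
          expR (- (2 * (shift b (u i) * g l i - centered_shift b (u i) * a i)) / beta).
        rewrite bigA_distr_bigA; apply: eq_bigr => e _.
        by rewrite /q /cross -big_split.
      have -> : expR (rho / beta) * expR (conc l) = expR (base l) *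
          \prod_i expR ((trunc_curv (u i) * (g l i - a i) ^+ 2 + rest (u i)) / (N * beta)).
        rewrite -expR_sum -!expRD; congr expR.
        rewrite -mulr_suml /rho /conc /base !big_split /= !sumrN.
        by field; rewrite !gt_eqF.
      rewrite ler_pM2l ?expR_gt0//; apply: ler_prod => i _; apply/andP; split.
        by apply: sumr_ge0 => b _; rewrite mulr_ge0 ?flip_prob_ge0 ?expR_ge0.
      exact: coordinate_mgf_le.
  rewrite Rintegral_bZ; last first.
    by apply: bounded_measurableM => //; exact: bounded_measurable_expR.
  rewrite -[leRHS]mulr1 ler_pM2l ?expR_gt0//.
  apply: (@expR_concave_mean_le1 _ _ _ (4 * (1 + N^-1) * thr / beta)) => // i.
  by rewrite trunc_curv_ge0 trunc_curv_le.
have lnA e : ln (A e) = ln (I e) - ln Z + K e.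
  by rewrite /A lnM ?posrE ?divr_gt0 ?expR_gt0// ln_div ?posrE// expRK.
(* The tangent of the logarithm at [expR (rho / beta)]; averaged over [e] it plays the role of
   Jensen's inequality. *)
have lnA_le e : ln (A e) <= A e / expR (rho / beta) - 1 + rho / beta.
  have := @le_ln1Dx R (A e / expR (rho / beta) - 1).
  rewrite addrCA subrr addr0 ln_div ?posrE ?expR_gt0// expRK.
  rewrite ltrBrDl subrr divr_gt0 ?expR_gt0// => /(_ isT).
  by rewrite lerBlDr.
have : \sum_e q e * ln (A e) <= rho / beta.
  apply: (@le_trans _ _ (\sum_e q e * (A e / expR (rho / beta) - 1 + rho / beta))).
    by apply: ler_sum => e _; rewrite ler_wpM2l.
  have -> : \sum_e q e * (A e / expR (rho / beta) - 1 + rho / beta) =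
      (\sum_e q e * A e) / expR (rho / beta) - 1 + rho / beta.
    transitivity (\sum_e (q e * A e / expR (rho / beta) + q e * (rho / beta - 1))).
      by apply: eq_bigr => e _; ring.
    by rewrite big_split /= -!mulr_suml q1 mul1r addrA addrAC.
  by rewrite gerDr subr_le0 ler_pdivrMr ?expR_gt0// mul1r.
have -> : \sum_e q e * ln (A e) =
    \sum_e q e * ln (I e) - ln Z + (N^-1 * \sum_i a i ^+ 2) / beta.
  transitivity (\sum_e (q e * ln (I e) + (- ln Z * q e + q e * K e))).
    by apply: eq_bigr => e _; rewrite lnA; ring.
  rewrite 2!big_split /= -mulr_sumr q1 mulr1 addrA; congr (_ + _).
  (* The part of [K] in the centered shifts averages to 0, so only the squared norm survives. *)
  have -> : \sum_e q e * K e = (\sum_e q e) * (N^-1 * (\sum_i a i ^+ 2) / beta) +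
      2 / beta * \sum_e q e * \sum_i centered_shift (e i) (u i) * a i.
    transitivity (\sum_e (q e * (N^-1 * (\sum_i a i ^+ 2) / beta) +
        2 / beta * (q e * \sum_i centered_shift (e i) (u i) * a i))).
      by apply: eq_bigr => e _; rewrite /K; ring.
    by rewrite big_split /= -[in LHS]mulr_suml -[in LHS]mulr_sumr.
  rewrite (@sum_ffun_prod_mean0 _ _ _ flip_prob
    (fun i b => centered_shift b (u i) * a i)).
    by rewrite q1 mulr0 addr0 mul1r.
  move=> i; transitivity ((\sum_b flip_prob b * centered_shift b (u i)) * a i).
    by rewrite mulr_suml; apply: eq_bigr => b _; rewrite mulrA.
  by rewrite centered_shift_mean mul0r.
rewrite -(ler_pM2l beta0) -/rho.
rewrite 2!mulrDr [beta * (rho / _)]mulrC divfK ?gt_eqF//.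
rewrite [beta * (_ / beta)]mulrC divfK ?gt_eqF// mulrN; lra.
Qed.

End PosteriorBound.

(** * The Donsker-Varadhan inequality *)

(** The upper function may have an infinite integral, so positive and negative parts are compared
    separately. *)
Lemma integral_ge_integrable (R : realType) (d : measure_display)
    (T : measurableType d) (mu : {measure set T -> \bar R}) (k f : T -> \bar R) :
  mu.-integrable setT k -> measurable_fun setT f ->
  {ae mu, forall t, setT t -> (k t <= f t)%E} ->
  (\int[mu]_t k t <= \int[mu]_t f t)%E.
Proof.
move=> ik mf kf; rewrite integralE [leRHS]integralE.
have mk := measurable_int _ ik.
apply: leeB.
  apply: ae_ge0_le_integral => //; first exact: measurable_funepos.
    exact: measurable_funepos.
  apply: filterS kf => t /(_ I) kt _.
  by rewrite !funeposE ge_max !le_max lexx orbT kt.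
apply: ae_ge0_le_integral => //; first exact: measurable_funeneg.
  exact: measurable_funeneg.
apply: filterS kf => t /(_ I) kt _.
by rewrite !funenegE ge_max !le_max lexx orbT leeN2 kt.
Qed.

Section DonskerVaradhan.
Context {R : realType} {d : measure_display} {T : measurableType d}.
Variables (p pi : probability T R) (h : T -> R).
Hypothesis bh : bounded_measurable h.

Local Notation dens := (Radon_Nikodym_SigmaFinite.f p pi).

Lemma measurable_lne_fin (f : T -> \bar R) : measurable_fun setT f ->
  (forall t, f t \is a fin_num) -> measurable_fun setT (fun t => lne (f t)).
Proof.
move=> mf ff; have mff : measurable_fun setT (fun t => fine (f t)).
  exact: measurableT_comp.
have -> : (fun t => lne (f t)) =
    fun t => if fine (f t) <= 0 then -oo%E else (ln (fine (f t)))%:E.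
  by apply/funext => t; case: (f t) (ff t).
apply: measurable_fun_ifT => //.
  exact: measurable_fun_ler.
by apply/measurable_EFinP; exact: measurableT_comp.
Qed.

(** With [w] the Gibbs density [expR h / C] divided by the density of [p], the inequality
    [ln w <= w - 1] gives [ln dens >= h - ln C + 1 - w] almost everywhere under [p]. The right side
    is integrable and [w] has mean at most 1. *)
Lemma KL_ge_Donsker_Varadhan :
  (((\int[p]_t h t)%R - ln (\int[pi]_t expR (h t))%R)%:E <= KL p pi)%E.
Proof.
rewrite /KL; case: (pselect (p `<< pi)) => [ppi|_] /=; last exact: leey.
(* This version of the derivative is nonnegative and finite everywhere; its almost sure agreement
   with the one in [KL] is used only at the end. *)
have f0 := Radon_Nikodym_SigmaFinite.f_ge0 ppi.
have ffin := Radon_Nikodym_SigmaFinite.f_fin_num ppi.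
have mf : measurable_fun setT dens.
  exact: measurable_int (Radon_Nikodym_SigmaFinite.f_integrable ppi).
have beh := bounded_measurable_expR bh.
set C := (\int[pi]_t expR (h t))%R; have C0 : 0 < C by exact: Rintegral_expR_gt0.
pose w t := expR (h t) / C * (fine (dens t)) `^ (-1).
have w0 t : 0 <= w t.
  by rewrite mulr_ge0 ?powR_ge0// divr_ge0 ?expR_ge0// ltW.
have mw : measurable_fun setT w.
  apply: measurable_funM.
    by apply: measurable_funM => //; case: beh.
  apply: (measurableT_comp (measurable_powR _)) => //.
  exact: measurableT_comp.
(* An inequality only: the Gibbs mass sitting where the density of [p] vanishes is lost. *)
have w1 : (\int[p]_t (w t)%:E <= 1)%E.
  have w0E t : (0 <= (w t)%:E)%E by rewrite lee_fin.
  have mwE : measurable_fun setT (EFin \o w) by exact/measurable_EFinP.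
  rewrite -(Radon_Nikodym_SigmaFinite.change_of_variables ppi w0E measurableT mwE).
  apply: (@le_trans _ _ (\int[pi]_t (C^-1 * expR (h t))%:E)%E).
    apply: ge0_le_integral => //.
    - by move=> t _; rewrite mule_ge0 ?lee_fin ?f0.
    - by apply: emeasurable_funM => //; exact/measurable_EFinP.
    - by apply/measurable_EFinP; case: (bounded_measurableZ C^-1 beh).
    - move=> t _; rewrite -(fineK (ffin t)) -EFinM lee_fin /w.
      have [->|f1] := eqVneq (fine (dens t)) 0.
        by rewrite mulr0 mulr_ge0 ?invr_ge0 ?(ltW C0) ?expR_ge0.
      by rewrite powR_inv1 ?fine_ge0// mulfVK// mulrC.
  have iCe := bounded_measurable_integrable pi (bounded_measurableZ C^-1 beh).
  rewrite -[leLHS]fineK; last exact: integrable_fin_num.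
  rewrite -[fine _]/(\int[pi]_t (C^-1 * expR (h t)))%R Rintegral_bZ// -/C.
  by rewrite mulVf// gt_eqF.
have iw : p.-integrable setT (EFin \o w).
  apply/integrableP; split; first exact/measurable_EFinP.
  under eq_integral do rewrite /= ger0_norm//.
  by apply: le_lt_trans w1 _; rewrite ltry.
pose k0 t := h t + (1 - ln C).
have bk0 : bounded_measurable k0.
  by apply: bounded_measurableD => //; exact: bounded_measurable_cst.
have ik0 := bounded_measurable_integrable p bk0.
have ik : p.-integrable setT (EFin \o (fun t => k0 t - w t)).
  by under [X in integrable _ _ X]eq_fun do rewrite /= EFinB; exact: integrableB.
apply: (@le_trans _ _ (\int[p]_t (k0 t - w t)%:E)%E).
  rewrite -[leRHS]fineK; last exact: integrable_fin_num.
  rewrite -[fine _]/(\int[p]_t (k0 t - w t))%R RintegralB// lee_fin.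
  rewrite Rintegral_bD//; last exact: bounded_measurable_cst.
  rewrite Rintegral_prob_cst.
  have : (\int[p]_t w t)%R <= 1.
    by rewrite -lee_fin fineK// ?integrable_fin_num.
  by lra.
apply: integral_ge_integrable => //.
  apply: measurable_lne_fin.
    exact: measurable_int (Radon_Nikodym_integrable _).
  by move=> t; exact: Radon_Nikodym_fin_num.
have aeRN : ae_eq p setT dens (Radon_Nikodym (charge_of_finite_measure p) pi).
  apply: (null_dominates_ae_eq measurableT ppi).
  exact: ae_eq_Radon_Nikodym_SigmaFinite.
have aepos : {ae p, forall t, (0 < dens t)%E}.
  have mN : measurable [set t | dens t = 0%E].
    rewrite -[X in measurable X]setTI.
    exact: (measurable_eqe measurableT mf (measurable_cst _)).
  exists [set t | dens t = 0%E]; split => //.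
    rewrite (Radon_Nikodym_SigmaFinite.f_integral ppi)//.
    by rewrite integral0_eq// => t.
  move=> t /= /negP; rewrite lt_neqAle f0 andbT negbK => /eqP. by move=> <-.
apply: filterS2 aeRN aepos => t /(_ I) <- fpos _.
rewrite -(fineK (ffin t)); have r0 : 0 < fine (dens t).
  by rewrite fine_gt0// fpos ltey_eq ffin.
rewrite lne_EFin// lee_fin /k0 /w.
set r := fine _ in r0 *; rewrite powR_inv1 ?(ltW r0)// -mulrA -invfM.
have := @le_ln1Dx R (expR (h t) / (C * r) - 1).
rewrite addrCA subrr addr0 ltrBrDl subrr divr_gt0 ?expR_gt0 ?mulr_gt0// => /(_ isT).
rewrite ln_div ?posrE ?expR_gt0 ?mulr_gt0// lnM ?posrE// expRK; lra.
Qed.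

End DonskerVaradhan.

(** * Invariance under sign flips *)

Section SymmetricLaw.
Context {R : realType}.

Lemma eq_measure_rays (m1 m2 : {finite_measure set R -> \bar R}) :
  (forall a, m1 `]a, +oo[%classic = m2 `]a, +oo[%classic) ->
  forall A, measurable A -> m1 A = m2 A.
Proof.
move=> m12 A mA.
apply: (measure_unique (@RGenOInfty.G R) (fun k => `](- k%:R)%R, +oo[%classic)) => //.
- exact: RGenOInfty.measurableE.
- move=> _ _ [a ->] [b ->]; exists (Num.max a b).
  by apply/seteqP; split => t /=; rewrite !in_itv/= !andbT gt_max => /andP.
- by move=> k; exists (- k%:R).
- apply/seteqP; split => // t _; exists (Num.truncn `|t|).+1 => //=.
  rewrite in_itv/= andbT ltrNl; apply: le_lt_trans (truncnS_gt _).
  by rewrite -normrN ler_norm.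
- by move=> _ [a ->]; exact: m12.
- by move=> k; rewrite ltey_eq fin_num_measure.
Qed.

(** Boxes are stable under intersection and generate the product sigma-algebra, since a preimage
    under one coordinate is a box with a single nontrivial side. *)
Lemma eq_measure_boxes (n : nat) (m1 m2 : {finite_measure set (n.-tuple R) -> \bar R}) :
  (forall B : 'I_n -> set R, (forall i, measurable (B i)) ->
    m1 [set v | forall i, B i (tnth v i)] = m2 [set v | forall i, B i (tnth v i)]) ->
  forall A, measurable A -> m1 A = m2 A.
Proof.
move=> m12.
pose G : set (set (n.-tuple R)) := [set A | exists2 B : 'I_n -> set R,
  (forall i, measurable (B i)) & A = [set v | forall i, B i (tnth v i)]].
have mG : G `<=` measurable.
  move=> _ [B mB ->].
  have -> : [set v : n.-tuple R | forall i, B i (tnth v i)] =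
      \bigcap_(i in [set: 'I_n]) ((fun v => tnth v i) @^-1` B i).
    by apply/seteqP; split => v /= h i; [move=> _|]; exact: h.
  apply: fin_bigcap_measurable; first exact: finite_finset.
  by move=> i _; rewrite -[X in measurable X]setTI; exact: measurable_tnth.
have GT : G setT by exists (fun=> setT) => //; apply/seteqP; split.
move=> A mA; apply: (g_sigma_algebra_measure_unique G mG (fun=> setT)) => //.
- by apply/seteqP; split => // t _; exists 0%N.
- move=> _ _ [B mB ->] [C mC ->]; exists (fun i => B i `&` C i).
    by move=> i; exact: measurableI.
  by apply/seteqP; split => v /=; [move=> [h1 h2] i; split|move=> h; split => i; have [] := h i].
- by move=> _ [B mB ->]; exact: m12.
- by move=> k; rewrite ltey_eq fin_num_measure.
- move: A mA; apply: smallest_sub; first exact: smallest_sigma_algebra.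
  rewrite -bigcup_seq => _ [i _ [B mB <-]]; apply: sub_sigma_algebra.
  exists (fun j => if j == i then B else setT).
    by move=> j; case: ifP.
  rewrite setTI; apply/seteqP; split => v /=.
    by move=> Bv j; case: eqP => [->|].
  by move=> /(_ i); rewrite eqxx.
Qed.

Section Flip.
Context {d : measure_display} {Omega : measurableType d}.
Variable P : probability Omega R.

(** Symmetry is assumed on rays only; uniqueness of finite measures carries it to all Borel sets. *)
Lemma symmetric_rv_opp (X : {RV P >-> R}) : symmetric_rv X ->
  forall A : set R, measurable A ->
  distribution P X ((-%R : R -> R) @^-1` A) = distribution P X A.
Proof.
move=> symX A mA.
have mN : measurable_fun setT (fun w => - X w) by exact: measurableT_comp.
pose NX : {mfun Omega >-> R} :=
  MeasurableFun.Pack (MeasurableFun.Class (isMeasurableFun.Build _ _ _ _ _ mN)).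
rewrite -[LHS]/(distribution P NX A).
apply: eq_measure_rays => // a; transitivity (P [set w | X w < - a]).
  congr (P _).
  by apply/seteqP; split => w /=; rewrite in_itv/= andbT ltrNr.
rewrite -symX; congr (P _).
by apply/seteqP; split => w /=; rewrite in_itv/= andbT.
Qed.

Definition flip_on (K : R -> bool) (t : R) : R := if K t then - t else t.

Lemma measurable_flip_on (K : R -> bool) : measurable_fun setT K ->
  measurable_fun setT (flip_on K).
Proof. by move=> mK; apply: measurable_fun_ifT => //; exact: oppr_measurable. Qed.

(** As [K] is even, reflection preserves it. The part of [A] inside [K] is reflected, which symmetry
    allows, and the part outside stays fixed. *)
Lemma symmetric_rv_flip_on (X : {RV P >-> R}) (K : R -> bool) :
  symmetric_rv X -> measurable_fun setT K -> (forall t, K (- t) = K t) ->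
  forall A : set R, measurable A ->
  distribution P X (flip_on K @^-1` A) = distribution P X A.
Proof.
move=> symX mK KN A mA; have mKA : measurable [set t | K t].
  rewrite -[X in measurable X]setTI.
  by have := mK measurableT [set true] I.
have -> : flip_on K @^-1` A =
    ((-%R : R -> R) @^-1` ([set t | K t] `&` A)) `|` (~` [set t | K t] `&` A).
  apply/seteqP; split => t /=; rewrite /flip_on KN.
    by case: ifP => Kt At; [left|right; split].
  by case: ifP => Kt [] [].
rewrite measureU; first last.
- apply/seteqP; split => // t /= [[+ _] [+ _]]; by rewrite KN.
- by apply: measurableI => //; exact: measurableC.
- rewrite -[X in measurable X]setTI; apply: oppr_measurable => //.
  exact: measurableI.
transitivity (distribution P X ([set t | K t] `&` A) +
              distribution P X (~` [set t | K t] `&` A))%E.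
  congr (_ + _)%E; apply: symmetric_rv_opp => //; exact: measurableI.
rewrite -measureU; first last.
- by apply/seteqP; split => // t /= [[? _] [? _]].
- by apply: measurableI => //; exact: measurableC.
- exact: measurableI.
by rewrite -setIUl setUv setTI.
Qed.

Variables (n : nat) (xi : 'I_n -> {RV P >-> R}).
Hypotheses (indep : mutually_independent xi) (sym : forall i, symmetric_rv (xi i)).

(** Both tuples have the same law: on boxes independence factors the probability, and each factor is
    invariant under its own flip. *)
Lemma integral_flip_on (K : R -> bool) (e : 'I_n -> bool) (H : n.-tuple R -> R) :
  measurable_fun setT K -> (forall t, K (- t) = K t) ->
  measurable_fun setT H ->
  P.-integrable setT (fun w => (H [tuple xi i w | i < n])%:E) ->
  P.-integrable setT (fun w =>
    (H [tuple (if e i then flip_on K (xi i w) else xi i w) | i < n])%:E) ->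
  (\int[P]_w (H [tuple (if e i then flip_on K (xi i w) else xi i w) | i < n])%:E =
   \int[P]_w (H [tuple xi i w | i < n])%:E)%E.
Proof.
move=> mK KN mH iX iY.
pose r i t := if e i then flip_on K t else t.
have mr i : measurable_fun setT (r i).
  by rewrite /r; case: (e i) => //; exact: measurable_flip_on.
have mX : measurable_fun setT (fun w => [tuple xi i w | i < n]).
  apply/measurable_fun_tnthP => i /=.
  rewrite (_ : _ \o _ = xi i)//.
  by apply/funext => w /=; rewrite tnth_mktuple.
have mY : measurable_fun setT (fun w => [tuple r i (xi i w) | i < n]).
  apply/measurable_fun_tnthP => i /=.
  rewrite (_ : _ \o _ = r i \o xi i); first exact: measurableT_comp.
  by apply/funext => w /=; rewrite tnth_mktuple.
pose X : {mfun Omega >-> n.-tuple R} :=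
  MeasurableFun.Pack (MeasurableFun.Class (isMeasurableFun.Build _ _ _ _ _ mX)).
pose Y : {mfun Omega >-> n.-tuple R} :=
  MeasurableFun.Pack (MeasurableFun.Class (isMeasurableFun.Build _ _ _ _ _ mY)).
have mHE : measurable_fun setT (EFin \o H) by exact/measurable_EFinP.
transitivity (\int[distribution P Y]_v (H v)%:E)%E.
  by rewrite -[RHS]/(\int[pushforward P Y]_v (EFin \o H) v)%E integral_pushforward.
transitivity (\int[distribution P X]_v (H v)%:E)%E; last first.
  by rewrite -[LHS]/(\int[pushforward P X]_v (EFin \o H) v)%E integral_pushforward.
apply: eq_measure_integral => A mA _; apply: eq_measure_boxes => // B mB.
have box (h : 'I_n -> Omega -> R) :
    (fun w => [tuple h i w | i < n]) @^-1` [set v | forall i, B i (tnth v i)] =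
    \bigcap_(i in [set` [set: 'I_n]%SET]) (h i @^-1` B i).
  apply/seteqP; split => w /= hw i; first by move=> _; have := hw i; rewrite tnth_mktuple.
  by rewrite tnth_mktuple; apply: hw; rewrite /= inE.
transitivity (P (\bigcap_(i in [set` [set: 'I_n]%SET]) (xi i @^-1` (r i @^-1` B i)))).
  by congr (P _); exact: (box (fun i w => r i (xi i w))).
rewrite indep; last by move=> i; rewrite -[X in measurable X]setTI; exact: mr.
transitivity (\prod_(i in [set: 'I_n]%SET) P (xi i @^-1` B i))%E.
  apply: eq_bigr => i _; rewrite /r; case: (e i) => //.
  exact: symmetric_rv_flip_on.
by rewrite -indep//; congr (P _); exact/esym/(box xi).
Qed.

End Flip.
End SymmetricLaw.

(** * Integrated risk *)

Section RealIntegrable.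
Context {R : realType} {d : measure_display} {T : measurableType d}.
Variable mu : {measure set T -> \bar R}.

Lemma integrable_EFinD (f h : T -> R) : mu.-integrable setT (EFin \o f) ->
  mu.-integrable setT (EFin \o h) ->
  mu.-integrable setT (EFin \o (fun t => f t + h t)).
Proof. by move=> mf mh; exact: (integrableD measurableT mf mh). Qed.

Lemma integrable_EFinZ (r : R) (f : T -> R) : mu.-integrable setT (EFin \o f) ->
  mu.-integrable setT (EFin \o (fun t => r * f t)).
Proof. by move=> mf; exact: (integrableZl measurableT r mf). Qed.

Lemma integrable_EFin_sum (I : Type) (r : seq I) (F : I -> T -> R) :
  (forall i, mu.-integrable setT (EFin \o F i)) ->
  mu.-integrable setT (EFin \o (fun t => \sum_(i <- r) F i t)).
Proof.
move=> iF; under [X in integrable _ _ X]eq_fun do rewrite /= -sumEFin.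
by apply: integrable_sum => // i _; exact: iF.
Qed.

Lemma Rintegral_integrable_sum (I : Type) (r : seq I) (F : I -> T -> R) :
  (forall i, mu.-integrable setT (EFin \o F i)) ->
  (\int[mu]_t (\sum_(i <- r) F i t) = \sum_(i <- r) \int[mu]_t F i t)%R.
Proof.
move=> iF; elim: r => [|i r IH].
  under eq_Rintegral do rewrite big_nil.
  by rewrite big_nil /Rintegral integral0.
under eq_Rintegral do rewrite big_cons.
by rewrite big_cons RintegralD ?IH//; exact: integrable_EFin_sum.
Qed.

End RealIntegrable.

Lemma measurable_Rintegral_ge0 (R : realType) (d1 d2 : measure_display)
    (T1 : measurableType d1) (T2 : measurableType d2) (mu : probability T2 R)
    (phi : T1 * T2 -> R) : measurable_fun setT phi -> (forall z, 0 <= phi z) ->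
  measurable_fun setT (fun t => (\int[mu]_l phi (t, l))%R).
Proof.
move=> mphi phi0; apply: (measurableT_comp (fine_measurable measurableT)).
apply: (@measurable_fun_fubini_tonelli_F _ _ _ _ _ mu (EFin \o phi)).
  exact/measurable_EFinP.
by move=> z; rewrite lee_fin.
Qed.

(** * Measurability and growth of the posterior quantities *)

Section Posterior.
Context {R : realType} {d : measure_display} {Lam : measurableType d}.
Variables (pi : probability Lam R) (n : nat) (g : Lam -> 'I_n -> R).
Variables (L beta : R).
Hypotheses (n0 : (0 < n)%N) (beta0 : 0 < beta) (L0 : 0 <= L).
Hypothesis mg : forall i, measurable_fun setT (fun l => g l i).
Hypothesis gL : forall l i, `|g l i| <= L.

Local Notation N := (n%:R : R).

Let N0 : 0 < N. Proof. by rewrite ltr0n. Qed.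

Definition log_partition (v : n.-tuple R) : R :=
  ln (\int[pi]_l expR ((1 + N^-1) * logw g beta (tnth v) l)).

Definition posterior_mean (v : n.-tuple R) (i : 'I_n) : R :=
  \int[pi]_l (expR (logw g beta (tnth v) l) /
    (\int[pi]_k expR (logw g beta (tnth v) k)) * g l i).

Lemma measurable_logw :
  measurable_fun setT (fun z : n.-tuple R * Lam => logw g beta (tnth z.1) z.2).
Proof.
apply: measurable_funM => //; apply: measurable_funN.
apply: measurable_sum => i.
have mgi : measurable_fun setT (fun z : n.-tuple R * Lam => g z.2 i).
  exact: (measurableT_comp (mg i)).
apply: measurable_funD; first exact: measurable_funX.
apply: measurable_funM => //; apply: measurable_funM => //.
exact: (measurableT_comp (measurable_tnth i)).
Qed.

Lemma measurable_log_partition : measurable_fun setT log_partition.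
Proof.
apply: (measurableT_comp (@measurable_ln R)).
apply: (@measurable_Rintegral_ge0 _ _ _ _ _ _
  (fun z => expR ((1 + N^-1) * logw g beta (tnth z.1) z.2))).
  apply: (measurableT_comp (@measurable_expR R)).
  by apply: measurable_funM => //; exact: measurable_logw.
by move=> z; exact: expR_ge0.
Qed.

Let bew u : bounded_measurable (fun l => expR (logw g beta u l)).
Proof. exact/bounded_measurable_expR/(bounded_measurable_logw _ mg gL). Qed.

(** Tonelli needs a nonnegative integrand, so [g] is raised by [L] inside the integral and [L] is
    subtracted afterwards. *)
Lemma measurable_posterior_mean i :
  measurable_fun setT (fun v => posterior_mean v i).
Proof.
pose Z (v : n.-tuple R) := (\int[pi]_k expR (logw g beta (tnth v) k))%R.
have -> : (fun v => posterior_mean v i) = (fun v =>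
    (Z v) `^ (-1) *
    (\int[pi]_l (expR (logw g beta (tnth v) l) * (g l i + L)))%R - L).
  apply/funext => v; have Z0 : 0 < Z v.
    exact/Rintegral_expR_gt0/(bounded_measurable_logw _ mg gL).
  have bg := bounded_measurable_g mg gL i.
  rewrite /posterior_mean -/(Z v) powR_inv1 ?(ltW Z0)//.
  transitivity (\int[pi]_l ((Z v)^-1 * (expR (logw g beta (tnth v) l) * g l i)))%R.
    by apply: eq_Rintegral => l _; rewrite -mulrA mulrCA.
  rewrite Rintegral_bZ; last exact: bounded_measurableM.
  have -> : (\int[pi]_l (expR (logw g beta (tnth v) l) * (g l i + L)))%R =
      (\int[pi]_l (expR (logw g beta (tnth v) l) * g l i +
                   L * expR (logw g beta (tnth v) l)))%R.
    by apply: eq_Rintegral => l _; ring.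
  rewrite Rintegral_bD; [|exact: bounded_measurableM|exact: bounded_measurableZ].
  rewrite Rintegral_bZ// -/(Z v) mulrDr [L * _]mulrC [_ * (Z v * _)]mulrA mulVf ?gt_eqF//.
  by rewrite mul1r addrK.
have mw := measurableT_comp (@measurable_expR R) measurable_logw.
apply: measurable_funB => //; apply: measurable_funM.
  apply: (measurableT_comp (measurable_powR _)).
  apply: (@measurable_Rintegral_ge0 _ _ _ _ _ _
    (fun z => expR (logw g beta (tnth z.1) z.2))).
    exact: mw.
  by move=> z; exact: expR_ge0.
apply: (@measurable_Rintegral_ge0 _ _ _ _ _ _
  (fun z => expR (logw g beta (tnth z.1) z.2) * (g z.2 i + L))).
  apply: measurable_funM; first exact: mw.
  by apply: measurable_funD => //; exact: (measurableT_comp (mg i)).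
move=> z; rewrite mulr_ge0 ?expR_ge0//.
by have := gL z.2 i; rewrite ler_norml -subr_ge0 opprK => /andP[? _]; lra.
Qed.

Lemma logw_norm_le u l :
  `|logw g beta u l| <= (\sum_i (L ^+ 2 + 2 * L * `|u i|)) / beta.
Proof.
rewrite normrM normfV (gtr0_norm beta0) ler_pM2r ?invr_gt0// normrN.
apply: le_trans (ler_norm_sum _ _ _) _; apply: ler_sum => i _.
apply: le_trans (ler_normD _ _) _; apply: lerD.
  by rewrite normrX lerXn2r ?nnegrE.
by rewrite !normrM ger0_norm// -!mulrA ler_pM2l// mulrC ler_wpM2r.
Qed.

(** Growth at most linear in the noise: a first moment then suffices for integrability. *)
Lemma log_partition_norm_le v :
  `|log_partition v| <=
  (1 + N^-1) * ((\sum_i (L ^+ 2 + 2 * L * `|tnth v i|)) / beta).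
Proof.
set M := (X in _ <= X).
have c0 : 0 < 1 + N^-1 by rewrite addr_gt0// invr_gt0.
have wM l : `|(1 + N^-1) * logw g beta (tnth v) l| <= M.
  by rewrite normrM (gtr0_norm c0) ler_pM2l// logw_norm_le.
have bw := bounded_measurableZ (1 + N^-1) (bounded_measurable_logw beta mg gL (tnth v)).
have I0 := Rintegral_expR_gt0 pi bw.
rewrite ler_norml -ler_expR -[_ <= M]ler_expR lnK ?posrE//; apply/andP; split.
  apply: Rintegral_ge_lb; first exact: bounded_measurable_expR.
  by move=> l; rewrite ler_expR; have := wM l; rewrite ler_norml => /andP[].
apply: Rintegral_le_ub; first exact: bounded_measurable_expR.
by move=> l; rewrite ler_expR; have := wM l; rewrite ler_norml => /andP[].
Qed.

End Posterior.

(** Weights of total 1 allow each flipped value to be paired with the unflipped one, so that each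
    difference has expectation 0. *)
Lemma weighted_sum_centered (R : comPzRingType) (I : finType) (q a : I -> R)
    (b c : R) : \sum_i q i = 1 ->
  \sum_i (- c * q i) * (a i + -1 * b) = - c * (\sum_i q i * a i) + c * b.
Proof.
move=> q1; transitivity (- c * (\sum_i q i * a i) + (\sum_i q i) * (c * b)).
  by rewrite mulr_sumr mulr_suml -big_split /=; apply: eq_bigr => i _; ring.
by rewrite q1 mul1r.
Qed.

(** * The risk bound, given a price [rest] for exceptional coordinates *)

Section Risk.
Context {R : realType} {dO : measure_display} {Omega : measurableType dO}.
Context {d : measure_display} {Lam : measurableType d}.
Variables (P : probability Omega R) (pi : probability Lam R).
Variables (n : nat) (xi : 'I_n -> {RV P >-> R}) (g : Lam -> 'I_n -> R).
Variables (L beta thr B : R) (rest : R -> R).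
Hypotheses (n0 : (0 < n)%N) (beta0 : 0 < beta) (L0 : 0 <= L).
Hypothesis mg : forall i, measurable_fun setT (fun l => g l i).
Hypothesis gL : forall l i, `|g l i| <= L.
Hypotheses (indep : mutually_independent xi) (sym : forall i, symmetric_rv (xi i)).
Hypothesis ixi : forall i, P.-integrable setT (EFin \o xi i).
Hypothesis xi0 : forall i, (\int[P]_w xi i w)%R = 0.
Hypothesis rest_ge0 : forall t, 0 <= rest t.
Hypothesis rest_inlier : forall t, inlier L beta t -> thr < 2 * t ^+ 2 ->
  4 * L ^+ 2 * curv n beta t <= rest t.
Hypothesis rest_outlier : forall t, ~~ inlier L beta t -> 2 * L * `|t| <= rest t.
Hypothesis irest : forall i, P.-integrable setT (EFin \o (fun w => rest (xi i w))).
Hypothesis restB : forall i, (\int[P]_w rest (xi i w))%R <= B.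
Hypotheses (thr0 : 0 <= thr)
  (thrL : 2 * L ^+ 2 <= beta * (1 - 4 * (1 + n%:R^-1) * thr / beta)).

Local Notation N := (n%:R : R).

Let N0 : 0 < N. Proof. by rewrite ltr0n. Qed.

Let G := log_partition pi g beta.
Let V w := [tuple xi i w | i < n].
Let F (e : {ffun 'I_n -> bool}) w :=
  [tuple (if e i then flip_on (inlier L beta) (xi i w) else xi i w) | i < n].

Lemma measurable_inlier : measurable_fun setT (inlier L beta).
Proof.
by apply: measurable_fun_ler => //; exact: measurable_funM.
Qed.

Lemma measurable_noise_tuple : measurable_fun setT V.
Proof.
apply/measurable_fun_tnthP => i; rewrite (_ : _ \o _ = xi i)//.
by apply/funext => w /=; rewrite tnth_mktuple.
Qed.

Lemma measurable_flipped_tuple e : measurable_fun setT (F e).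
Proof.
apply/measurable_fun_tnthP => i.
rewrite (_ : _ \o _ =
  (fun t => if e i then flip_on (inlier L beta) t else t) \o xi i).
  apply: measurableT_comp => //; case: (e i) => //.
  by apply: measurable_flip_on; exact: measurable_inlier.
by apply/funext => w /=; rewrite tnth_mktuple.
Qed.

Lemma integrable_log_partition (Y : Omega -> n.-tuple R) :
  measurable_fun setT Y -> (forall w i, `|tnth (Y w) i| <= `|xi i w|) ->
  P.-integrable setT (EFin \o (fun w => G (Y w))).
Proof.
move=> mY Yxi.
pose b w := (1 + N^-1) * (beta^-1 * \sum_i (L ^+ 2 + 2 * L * `|xi i w|)).
have ib : P.-integrable setT (EFin \o b).
  apply/integrable_EFinZ/integrable_EFinZ/integrable_EFin_sum => i.
  apply: integrable_EFinD.
    exact/bounded_measurable_integrable/bounded_measurable_cst.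
  apply: integrable_EFinZ; exact: (integrable_norm (ixi i)).
apply: (le_integrable measurableT _ _ ib).
  apply/measurable_EFinP; apply: measurableT_comp => //.
  exact: measurable_log_partition.
move=> w _ /=; rewrite lee_fin.
apply: le_trans (ler_norm _).
apply: le_trans (log_partition_norm_le _ n0 beta0 L0 mg gL _) _.
rewrite [X in _ * X]mulrC /b ler_pM2l ?addr_gt0 ?invr_gt0//.
rewrite ler_pM2l ?invr_gt0//; apply: ler_sum => i _.
by rewrite lerD2l ler_wpM2l// mulr_ge0.
Qed.

Lemma integrable_noise_log_partition : P.-integrable setT (EFin \o (fun w => G (V w))).
Proof.
apply: integrable_log_partition; first exact: measurable_noise_tuple.
by move=> w i; rewrite tnth_mktuple.
Qed.

Lemma integrable_flipped_log_partition e :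
  P.-integrable setT (EFin \o (fun w => G (F e w))).
Proof.
apply: integrable_log_partition; first exact: measurable_flipped_tuple.
by move=> w i; rewrite tnth_mktuple /flip_on; case: ifP => // _; case: ifP; rewrite ?normrN.
Qed.

Lemma Rintegral_flipped_log_partition e :
  (\int[P]_w G (F e w))%R = (\int[P]_w G (V w))%R.
Proof.
have iV := integrable_noise_log_partition.
have iF := integrable_flipped_log_partition e.
have Ksym t : inlier L beta (- t) = inlier L beta t by rewrite /inlier normrN.
have mG : measurable_fun setT G by exact: measurable_log_partition.
have E := integral_flip_on indep sym measurable_inlier Ksym mG iV iF.
exact: (congr1 fine E).
Qed.

Variable p : probability Lam R.
Hypothesis KLfin : (KL p pi < +oo)%E.

(** Donsker-Varadhan for the scaled log-weight, whose mean under [p] is explicit. *)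
Lemma log_partition_ge (v : n.-tuple R) :
  - G v <= fine (KL p pi) + (1 + N^-1) / beta *
    (\sum_i \int[p]_l (g l i ^+ 2) + 2 * \sum_i tnth v i * \int[p]_l g l i).
Proof.
have bh := bounded_measurableZ (1 + N^-1) (bounded_measurable_logw beta mg gL (tnth v)).
have := KL_ge_Donsker_Varadhan p pi bh; rewrite -[ln _]/(G v).
have KLy : KL p pi \is a fin_num.
  rewrite fin_numElt KLfin andbT.
  exact: lt_le_trans (ltNyr _) (KL_ge_Donsker_Varadhan p pi bh).
rewrite -{1}(fineK KLy) lee_fin => h.
have bg := bounded_measurable_g mg gL.
suff E : (\int[p]_l ((1 + N^-1) * logw g beta (tnth v) l))%R =
    - ((1 + N^-1) / beta *
    (\sum_i (\int[p]_l (g l i ^+ 2))%R +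
     2 * \sum_i tnth v i * (\int[p]_l g l i)%R)).
  by move: h; rewrite E; lra.
transitivity (\int[p]_l (- ((1 + N^-1) / beta) *
    \sum_i (g l i ^+ 2 + 2 * tnth v i * g l i)))%R.
  by apply: eq_Rintegral => l _; rewrite /logw; ring.
have bi i : bounded_measurable (fun l => g l i ^+ 2 + 2 * tnth v i * g l i).
  apply: bounded_measurableD; first exact: bounded_measurableX.
  exact: bounded_measurableZ.
rewrite Rintegral_bZ; last exact: bounded_measurable_sum.
rewrite Rintegral_bsum// mulNr; congr (- (_ * _)).
rewrite mulr_sumr -big_split /=; apply: eq_bigr => i _.
by rewrite Rintegral_bD ?Rintegral_bZ ?mulrA//; [exact: bounded_measurableX
  |exact: bounded_measurableZ].
Qed.

Let q (e : {ffun 'I_n -> bool}) : R := \prod_i flip_prob n (e i).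

(** A bound for each outcome, arranged for integration: the first sum has mean 0 by flip invariance,
    the noise sum has mean 0 by centering, and the rest is the claimed risk. *)
Let dominating w : R :=
  \sum_e (- beta * q e) * (G (F e w) + -1 * G (V w)) +
  ((beta / n.+1%:R * fine (KL p pi) + N^-1 * \sum_i (\int[p]_l (g l i ^+ 2))%R) +
   (\sum_i (2 / N * (\int[p]_l g l i)%R) * xi i w +
    N^-1 * \sum_i rest (xi i w))).

(** Jensen with exponent [N / (N + 1)], the inverse of [1 + N^-1], bounds [lnZ] by [G (V w)] minus
    its share [1 / (N + 1)]. Donsker-Varadhan bounds that negative share, which yields the factor
    [beta / n.+1] of the divergence. *)
Lemma sqnorm_posterior_mean_le_dominating w :
  N^-1 * \sum_i posterior_mean pi g beta (V w) i ^+ 2 <= dominating w.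
Proof.
have q1 : \sum_e q e = 1 by exact/sum_ffun_prod1/flip_prob_sum.
have NS : n.+1%:R = N + 1 by rewrite -addn1 natrD.
have := sqnorm_posterior_mean_le n0 beta0 L0 mg gL rest_ge0 rest_inlier
  rest_outlier thr0 thrL (fun i => erefl (posterior_mean pi g beta (V w) i)).
set lnZ := ln _; set S1 := \sum_(e : {ffun 'I_n -> bool}) _ => h1.
have h2 : lnZ <= N / (N + 1) * G (V w).
  rewrite /lnZ; have -> : (\int[pi]_l expR (logw g beta (tnth (V w)) l))%R =
     (\int[pi]_l expR (N / (N + 1) * ((1 + N^-1) * logw g beta (tnth (V w)) l)))%R.
    apply: eq_Rintegral => l _; congr expR.
    by field; rewrite !gt_eqF ?addr_gt0.
  apply: ln_Rintegral_expR_scale.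
    rewrite divr_ge0 ?(ltW N0) ?addr_ge0 ?(ltW N0)//=.
    by rewrite ler_pdivrMr ?addr_gt0// mul1r lerDl.
  exact/bounded_measurableZ/(bounded_measurable_logw _ mg gL).
have h3 := log_partition_ge (V w).
have uE (e : {ffun 'I_n -> bool}) :
    (fun i => flip L beta (e i) (tnth (V w) i)) = tnth (F e w).
  apply/funext => i; rewrite !tnth_mktuple /flip /flip_on.
  by case: (e i).
have S1E : S1 = \sum_e q e * G (F e w).
  by rewrite /S1; apply: eq_bigr => e _; rewrite uE.
have S2E : \sum_e (- beta * q e) * (G (F e w) + -1 * G (V w)) =
    - beta * S1 + beta * G (V w).
  by rewrite S1E; exact: weighted_sum_centered.
have restE : \sum_i rest (tnth (V w) i) = \sum_i rest (xi i w).
  by apply: eq_bigr => i _; rewrite tnth_mktuple.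
have noiseE : \sum_i (2 / N * (\int[p]_l g l i)%R) * xi i w =
    2 / N * \sum_i tnth (V w) i * (\int[p]_l g l i)%R.
  rewrite mulr_sumr; apply: eq_bigr => i _.
  by rewrite tnth_mktuple mulrAC mulrA.
rewrite /dominating S2E noiseE NS; rewrite restE in h1.
apply: le_trans h1 _; move: h2 h3.
move: (\sum_i tnth (V w) i * _) (\sum_i (\int[p]_l (g l i ^+ 2))%R) (G (V w))
  (fine (KL p pi)) (\sum_i rest (xi i w)) S1 lnZ {S1E S2E restE noiseE NS}.
move=> m sq y K r S1 z h2 h3.
have e3 : - (beta / (N + 1) * y) <= beta / (N + 1) * K + N^-1 * sq + 2 / N * m.
  rewrite -mulrN; apply: (@le_trans _ _ (beta / (N + 1) *
    (K + (1 + N^-1) / beta * (sq + 2 * m)))).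
    by rewrite ler_pM2l// divr_gt0// addr_gt0.
  rewrite le_eqVlt; apply/orP; left; apply/eqP.
  by field; rewrite !gt_eqF ?addr_gt0.
have e2 : beta * z <= beta * y - beta / (N + 1) * y.
  apply: (@le_trans _ _ (beta * (N / (N + 1) * y))); first by rewrite ler_pM2l.
  rewrite le_eqVlt; apply/orP; left; apply/eqP.
  by field; rewrite gt_eqF ?addr_gt0.
lra.
Qed.

Lemma posterior_mean_risk_le :
  (\int[P]_w (N^-1 * \sum_i posterior_mean pi g beta (V w) i ^+ 2)%:E <=
   (beta / n.+1%:R * fine (KL p pi)
    + N^-1 * \sum_i (\int[p]_l (g l i ^+ 2))%R + B)%:E)%E.
Proof.
have iG e : P.-integrable setT (EFin \o
    (fun w => (- beta * q e) * (G (F e w) + -1 * G (V w)))).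
  apply/integrable_EFinZ/integrable_EFinD; first exact: integrable_flipped_log_partition.
  exact/integrable_EFinZ/integrable_noise_log_partition.
have iS1 := integrable_EFin_sum (index_enum {ffun 'I_n -> bool}) iG.
have iN i := integrable_EFinZ (2 / N * (\int[p]_l g l i)%R) (ixi i).
have iS2 := integrable_EFin_sum (index_enum 'I_n) iN.
have iS3 := integrable_EFin_sum (index_enum 'I_n) irest.
set c := beta / n.+1%:R * _ + _.
have ic : P.-integrable setT (EFin \o (fun=> c)).
  exact/bounded_measurable_integrable/bounded_measurable_cst.
have iS23 := integrable_EFinD iS2 (integrable_EFinZ N^-1 iS3).
have iD : P.-integrable setT (EFin \o dominating).
  exact: (integrable_EFinD iS1 (integrable_EFinD ic iS23)).
apply: (@le_trans _ _ (\int[P]_w (dominating w)%:E)%E).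
  apply: ge0_le_integral => //.
  - move=> w _; rewrite lee_fin mulr_ge0 ?invr_ge0 ?(ltW N0)//.
    by apply: sumr_ge0 => i _; exact: sqr_ge0.
  - apply/measurable_EFinP/measurable_funM => //; apply: measurable_sum => i.
    apply: measurable_funX.
    have mpm := measurable_posterior_mean pi beta mg gL i.
    exact: (measurableT_comp mpm measurable_noise_tuple).
  - exact: measurable_int iD.
  - by move=> w _; rewrite lee_fin; exact: sqnorm_posterior_mean_le_dominating.
rewrite -[leLHS]fineK ?integrable_fin_num// lee_fin.
rewrite -[fine _]/(\int[P]_w dominating w)%R /dominating -/c.
rewrite RintegralD//; last exact: (integrable_EFinD ic iS23).
rewrite RintegralD// Rintegral_prob_cst RintegralD//; last exact: integrable_EFinZ.
rewrite Rintegral_integrable_sum// big1 ?add0r => [|e _]; last first.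
  rewrite RintegralZl//; last first.
    apply/integrable_EFinD; first exact: integrable_flipped_log_partition.
    exact/integrable_EFinZ/integrable_noise_log_partition.
  rewrite RintegralD//; [|exact: integrable_flipped_log_partition
    |exact/integrable_EFinZ/integrable_noise_log_partition].
  rewrite RintegralZl//; last exact: integrable_noise_log_partition.
  rewrite [X in _ * (X + _)](Rintegral_flipped_log_partition e).
  by rewrite mulN1r subrr mulr0.
rewrite lerD2l Rintegral_integrable_sum// big1 ?add0r => [|i _]; last first.
  by rewrite RintegralZl// xi0 mulr0.
rewrite RintegralZl// Rintegral_integrable_sum// ler_pdivrMl//.
apply: (@le_trans _ _ (\sum_(i < n) B)); first exact: ler_sum.
by rewrite sumr_const card_ord mulr_natl.
Qed.

End Risk.

(** * Tail terms and the rate *)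

(** The Markov trade-off: beyond [t0], the missing factor [t] to the power [s - k] is at least its
    value at [t0]. *)
Lemma powR_le_tail (R : realType) (t t0 k s : R) : 0 < t0 -> t0 <= t -> k <= s ->
  t `^ k <= t `^ s * t0 `^ (- (s - k)).
Proof.
move=> t00 t0t ks; have tp := lt_le_trans t00 t0t.
rewrite powRN ler_pdivlMr ?powR_gt0//.
have -> : t `^ s = t `^ k * t `^ (s - k).
  by rewrite -powRD ?(gt_eqF tp) ?implybT// addrC subrK.
rewrite ler_pM2l ?powR_gt0// ge0_ler_powR ?nnegrE ?subr_ge0//; exact: ltW.
Qed.

Lemma KL_gtNy (R : realType) (d : measure_display) (T : measurableType d)
  (p pi : probability T R) : (-oo < KL p pi)%E.
Proof.
exact: lt_le_trans (ltNyr _)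
  (KL_ge_Donsker_Varadhan p pi (bounded_measurable_cst (0 : R))).
Qed.

(** * The error of the aggregate as a posterior mean *)

Section EwaError.
Context {R : realType} {d : measure_display} {Lam : measurableType d}.
Variables (X : Type) (n : nat) (x : 'I_n -> X) (f : X -> R) (F : Lam -> X -> R).
Variables (pi : probability Lam R) (L beta : R).
Hypothesis n0 : (0 < n)%N.
Hypothesis mF : forall t, measurable_fun setT (fun l => F l t).
Hypothesis FL : forall l t, `|f t - F l t| <= L.

Local Notation g := (fun l i => f (x i) - F l (x i)).

(** The factor depending on [u] alone is constant in [l] and cancels on normalization. *)
Lemma gibbsE (u : 'I_n -> R) l :
  gibbs x F beta (fun i => f (x i) + u i) l =
  expR (- (\sum_i u i ^+ 2) / beta) * expR (logw g beta u l).
Proof.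
have E : \sum_i (f (x i) + u i - F l (x i)) ^+ 2 = \sum_i u i ^+ 2 +
    \sum_i ((f (x i) - F l (x i)) ^+ 2 + 2 * u i * (f (x i) - F l (x i))).
  by rewrite -big_split; apply: eq_bigr => i _ /=; ring.
rewrite -expRD /gibbs /logw /sqnorm mulrA mulfV ?pnatr_eq0 -?lt0n// mul1r E.
by congr expR; rewrite -mulNr opprD mulrDl.
Qed.

Lemma ewa_error (u : 'I_n -> R) i :
  ewa x F pi beta (fun j => f (x j) + u j) (x i) - f (x i) =
  - (\int[pi]_l (expR (logw g beta u l) /
      (\int[pi]_k expR (logw g beta u k)) * g l i))%R.
Proof.
have mg j : measurable_fun setT (fun l => g l j) by exact: measurable_funB.
have gL l j : `|g l j| <= L by exact: FL.
have bw := bounded_measurable_logw beta mg gL u.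
have bew := bounded_measurable_expR bw.
have Z0 := Rintegral_expR_gt0 pi bw; set Z := Rintegral _ _ _ in Z0.
have thetaE l : theta x F pi beta (fun j => f (x j) + u j) l =
    expR (logw g beta u l) / Z.
  rewrite /theta gibbsE (_ : (\int[pi]_l gibbs x F beta _ l)%R =
     expR (- (\sum_i u i ^+ 2) / beta) * Z); last first.
    by rewrite -Rintegral_bZ//; apply: eq_Rintegral => k _; rewrite gibbsE.
  by rewrite invfM mulrACA mulfV ?mul1r// gt_eqF// expR_gt0.
have bt : bounded_measurable (fun l => Z^-1 * expR (logw g beta u l)).
  exact: bounded_measurableZ.
have bg := bounded_measurable_g mg gL i.
have -> : ewa x F pi beta (fun j => f (x j) + u j) (x i) =
    (\int[pi]_l (f (x i) * (Z^-1 * expR (logw g beta u l)) +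
                 -1 * (Z^-1 * expR (logw g beta u l) * g l i)))%R.
  by apply: eq_Rintegral => l _; rewrite thetaE; ring.
have btg := bounded_measurableM bt bg.
rewrite Rintegral_bD; [|exact: bounded_measurableZ|exact: bounded_measurableZ].
rewrite !Rintegral_bZ// -/Z mulVf ?gt_eqF// mulr1 mulN1r addrAC subrr add0r.
by congr (- _); apply: eq_Rintegral => l _; rewrite [_^-1 * _]mulrC.
Qed.

End EwaError.

(** * The price of exceptional coordinates *)

Section TailRemainder.
Context {R : realType}.
Variables (s L alpha0 beta : R) (n : nat).
Hypotheses (n0 : (0 < n)%N) (hs : 2 <= s) (L0 : 0 <= L) (halpha0 : 0 < alpha0).

Local Notation N := (n%:R : R).

Let N1 : 1 <= N. Proof. by rewrite ler1n. Qed.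
Let NV0 : 0 < N^-1. Proof. by rewrite invr_gt0 ltr0n. Qed.
Let s20 : 0 < s + 2. Proof. by move: hs; lra. Qed.

(** In this unit the scale of [beta] is a square and the rate is the power [- s]. *)
Definition rate_base : R := N `^ (s + 2)^-1.

Lemma rate_base_ge1 : 1 <= rate_base.
Proof.
by rewrite /rate_base -[leLHS](powRr0 N) ler_powR// invr_ge0 ltW.
Qed.

Let M0 : 0 < rate_base. Proof. exact: lt_le_trans rate_base_ge1. Qed.

Lemma powR_rate_sqr : N `^ (2 / (s + 2)) = rate_base ^+ 2.
Proof. by rewrite mulrC powRrM powR_mulrn// powR_ge0. Qed.

Lemma powR_rate : N `^ (- (s / (s + 2))) = rate_base `^ (- s).
Proof. by rewrite -mulNr mulrC powRrM. Qed.

(** The first summand pays for large inliers, where [|t|] is at least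
    [Num.sqrt (alpha0 / 2) * rate_base]; the second for outliers, where [|t|] is at least
    [alpha0 / (16 * (L + 1)) * rate_base ^+ 2]. *)
Definition tail_const : R :=
  8 * L ^+ 2 / alpha0 * Num.sqrt (alpha0 / 2) `^ (- (s - 2)) +
  2 * L * (alpha0 / (16 * (L + 1))) `^ (- (s - 1)).

Definition tail_rest (t : R) : R :=
  tail_const * rate_base `^ (- s) * `|t| `^ s.

Lemma tail_const_ge0 : 0 <= tail_const.
Proof.
by rewrite addr_ge0// !mulr_ge0 ?powR_ge0 ?invr_ge0 ?sqr_ge0 ?(ltW halpha0).
Qed.

Lemma tail_rest_ge0 t : 0 <= tail_rest t.
Proof. by rewrite !mulr_ge0 ?powR_ge0 ?tail_const_ge0. Qed.

Hypothesis beta_ge : 4 * (1 + N^-1) * (alpha0 * rate_base ^+ 2) <= beta.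

(** The lower bound on [beta] gives a factor [M ^- 2], and trading [t ^+ 2] for the power [s] gives
    [M] to the power [- (s - 2)]; together they make the rate. *)
Lemma tail_rest_large t : alpha0 * rate_base ^+ 2 < 2 * t ^+ 2 ->
  4 * L ^+ 2 * curv n beta t <= tail_rest t.
Proof.
move=> tbig; have Mgt0 := M0; have bge := beta_ge.
set M := rate_base in Mgt0 tbig bge *.
have thr0 : 0 < alpha0 * M ^+ 2 by rewrite mulr_gt0 ?exprn_gt0.
have c0 : 0 < 1 + N^-1 by rewrite addr_gt0.
have beta0 : 0 < beta by apply: lt_le_trans bge; rewrite !mulr_gt0.
set r := Num.sqrt (alpha0 / 2); have r0 : 0 < r by rewrite sqrtr_gt0 divr_gt0.
have rE : r ^+ 2 = alpha0 / 2 by rewrite sqr_sqrtr// divr_ge0 ?ltW.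
have rt : r * M <= `|t|.
  rewrite -(@ler_pXn2r _ 2) ?nnegrE ?mulr_ge0 ?(ltW r0) ?(ltW Mgt0)//.
  by rewrite real_normK ?num_real// exprMn rE; lra.
have := powR_le_tail (mulr_gt0 r0 Mgt0) rt hs.
rewrite powR_mulrn// real_normK ?num_real// powRM ?(ltW r0) ?(ltW Mgt0)// => tle.
have curvle : 4 * L ^+ 2 * curv n beta t <= 8 * L ^+ 2 * t ^+ 2 / (alpha0 * M ^+ 2).
  rewrite /curv; have -> : 4 * L ^+ 2 * (8 * (1 + N^-1) * t ^+ 2 / beta) =
     8 * L ^+ 2 * t ^+ 2 * (4 * (1 + N^-1) / beta) by ring.
  apply: ler_wpM2l; first by rewrite mulr_ge0 ?sqr_ge0// mulr_ge0 ?sqr_ge0.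
  by rewrite ler_pdivrMr// [leRHS]mulrC ler_pdivlMr.
apply: le_trans curvle _.
apply: (@le_trans _ _ (8 * L ^+ 2 / alpha0 * r `^ (- (s - 2)) * M `^ (- s) * `|t| `^ s)).
  have -> : 8 * L ^+ 2 * t ^+ 2 / (alpha0 * M ^+ 2) =
      8 * L ^+ 2 / alpha0 * (M ^- 2 * t ^+ 2).
    by field; rewrite !gt_eqF.
  have -> : M `^ (- s) = M ^- 2 * M `^ (- (s - 2)).
    rewrite -powR_invn ?(ltW Mgt0)// -powRD; last by rewrite (gt_eqF Mgt0) implybT.
    by congr (_ `^ _); ring.
  set A := 8 * L ^+ 2 / alpha0; have A0 : 0 <= A.
    by rewrite divr_ge0 ?(ltW halpha0)// mulr_ge0 ?sqr_ge0.
  have -> : A * r `^ (- (s - 2)) * (M ^- 2 * M `^ (- (s - 2))) * `|t| `^ s =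
      A * (M ^- 2 * (`|t| `^ s * (r `^ (- (s - 2)) * M `^ (- (s - 2))))) by ring.
  apply: ler_wpM2l => //; apply: ler_wpM2l => //.
  by rewrite invr_ge0 exprn_ge0 ?ltW.
rewrite /tail_rest -/M; apply: ler_wpM2r; first exact: powR_ge0.
apply: ler_wpM2r; first exact: powR_ge0.
by rewrite lerDl mulr_ge0 ?powR_ge0// mulr_ge0.
Qed.

(** An outlier is of order [M ^+ 2], so trading [|t|] for the power [s] gains [M] to the power
    [- 2 * (s - 1)], at most the rate since [2 <= s] and [1 <= M]. *)
Lemma tail_rest_outlier t : ~~ inlier L beta t -> 2 * L * `|t| <= tail_rest t.
Proof.
rewrite /inlier -ltNge => tbig; have Mgt0 := M0; have bge := beta_ge.
set M := rate_base in Mgt0 tbig bge *.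
have M1 : 1 <= M by exact: rate_base_ge1.
set r := alpha0 / (16 * (L + 1)).
have L1 : 0 < L + 1 by rewrite ltr_wpDl.
have r0 : 0 < r by rewrite divr_gt0// mulr_gt0.
have rt : r * M ^+ 2 <= `|t|.
  rewrite /r mulrAC ler_pdivrMr ?mulr_gt0//.
  have : alpha0 * M ^+ 2 <= (1 + N^-1) * (alpha0 * M ^+ 2).
    by rewrite ler_peMl ?lerDl ?(ltW NV0)// mulr_ge0 ?sqr_ge0// ltW.
  move: tbig bge; nra.
have := powR_le_tail (mulr_gt0 r0 (exprn_gt0 2 Mgt0)) rt (le_trans (ler1n _ 2) hs).
rewrite powRr1// powRM ?(ltW r0) ?exprn_ge0 ?(ltW Mgt0)// => tle.
have Mle : (M ^+ 2) `^ (- (s - 1)) <= M `^ (- s).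
  have -> : (M ^+ 2) `^ (- (s - 1)) = M `^ (2 * - (s - 1)).
    by rewrite powRrM powR_mulrn ?ltW.
  by apply: ler_powR => //; move: hs {rt tle tbig bge}; lra.
apply: (@le_trans _ _ (2 * L * (r `^ (- (s - 1)) * M `^ (- s) * `|t| `^ s))).
  apply: ler_wpM2l; first by rewrite mulr_ge0.
  apply: le_trans tle _; rewrite mulrC.
  by apply: ler_wpM2r; [exact: powR_ge0|apply: ler_wpM2l; [exact: powR_ge0|]].
rewrite /tail_rest -/M !mulrA; apply: ler_wpM2r; first exact: powR_ge0.
apply: ler_wpM2r; first exact: powR_ge0.
rewrite lerDr mulr_ge0 ?powR_ge0// divr_ge0 ?(ltW halpha0)//.
by rewrite mulr_ge0 ?sqr_ge0.
Qed.

End TailRemainder.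

Theorem corollary3 (R : realType) (s L B alpha0 : R) (hs : 2 <= s)
    (hB : 0 < B) (halpha0 : 0 < alpha0) :
  exists2 Cbar : R, 0 < Cbar &
  forall (dOmega : measure_display) (Omega : measurableType dOmega)
    (P : probability Omega R)
    (dLambda : measure_display) (Lambda : measurableType dLambda)
    (X : Type) (n : nat) (x : 'I_n -> X) (f : X -> R)
    (xi : 'I_n -> {RV P >-> R}) (F : Lambda -> X -> R)
    (pi : probability Lambda R) (beta : R),
  (0 < n)%N ->
  mutually_independent xi ->
  identically_distributed xi ->
  (forall i, 'E_P[xi i] = 0)%E ->
  (forall t, measurable_fun setT (fun l => F l t)) ->
  (ereal_sup [set sup_norm (fun t => f t - F l t)%R | l in [set: Lambda]]
     <= L%:E)%E ->
  (forall i, symmetric_rv (xi i)) ->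
  (forall i, 'E_P[fun w => (`|xi i w| `^ s)%R] <= B%:E)%E ->
  4 * (1 + n%:R^-1) * alpha0 * n%:R `^ (2 / (s + 2)) + 2 * L ^+ 2 <= beta ->
  forall p : probability Lambda R,
  ('E_P[fun w => sqdist x (ewa x F pi beta (fun i => f (x i) + xi i w)%R) f]
   <= \int[p]_l (sqdist x (F l) f)%:E
      + (beta / n.+1%:R)%:E * KL p pi
      + (Cbar * n%:R `^ (- (s / (s + 2))))%:E)%E.
Proof.
have C0 : 0 <= tail_const s `|L| alpha0 by exact: tail_const_ge0.
(* The constant is fixed before [L] is known to be nonnegative, hence the absolute value; the added
   1 makes it positive even when the tail constant is 0. *)
exists (tail_const s `|L| alpha0 * B + 1).
  by rewrite ltr_wpDl// mulr_ge0// ltW.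
move=> dOmega Omega P dLambda Lambda X n x f xi F pi beta n0 indep _ xi0 mF supL
  sym xis beta_ge p.
have FL l t : `|f t - F l t| <= L.
  rewrite -lee_fin; apply: le_trans supL.
  apply: (@le_trans _ _ (sup_norm (fun t => f t - F l t))).
    by apply: ereal_sup_ubound; exists t.
  by apply: ereal_sup_ubound; exists l.
(* A parameter exists because [pi] has mass 1, and a design point because [n] is positive. *)
have L0 : 0 <= L.
  have [l _] : exists l : Lambda, True.
    apply: contrapT => noL.
    have : (pi setT = 0)%E.
      rewrite (_ : setT = set0) ?measure0//.
      by apply/seteqP; split => // l _; apply: noL; exists l.
    by rewrite probability_setT => /eqP; rewrite onee_eq0.
  exact: le_trans (FL l (x (Ordinal n0))).
rewrite (ger0_norm L0) in C0 *.
have N0 : 0 < n%:R :> R by rewrite ltr0n.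
rewrite powR_rate powR_rate_sqr in beta_ge *.
set M := rate_base s n in beta_ge *.
have thr_gt0 : 0 < alpha0 * M ^+ 2.
  by rewrite mulr_gt0// exprn_gt0// (lt_le_trans _ (rate_base_ge1 n0 hs)).
have c0 : 0 < 1 + n%:R^-1 :> R by rewrite addr_gt0// invr_gt0.
have beta_ge' : 4 * (1 + n%:R^-1) * (alpha0 * M ^+ 2) <= beta.
  by apply: le_trans beta_ge; rewrite mulrA lerDl mulr_ge0 ?sqr_ge0.
have beta0 : 0 < beta by apply: lt_le_trans beta_ge'; rewrite mulr_gt0// mulr_gt0.
(* The hypothesis on [beta], rearranged into the concavity condition at threshold
   [alpha0 * M ^+ 2]. *)
have thrL : 2 * L ^+ 2 <=
    beta * (1 - 4 * (1 + n%:R^-1) * (alpha0 * M ^+ 2) / beta).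
  rewrite mulrBr mulr1 [beta * (_ / _)]mulrC divfK ?gt_eqF//.
  by rewrite lerBrDl mulrA.
pose g l i := f (x i) - F l (x i).
have mg i : measurable_fun setT (fun l => g l i) by exact: measurable_funB.
have gL l i : `|g l i| <= L by exact: FL.
have bg := bounded_measurable_g mg gL.
have ipow i : P.-integrable setT (EFin \o (fun w => `|xi i w| `^ s)).
  apply/integrableP; split.
    apply/measurable_EFinP; apply: (measurableT_comp (measurable_powR _)).
    exact: measurableT_comp.
  under eq_integral do rewrite /= ger0_norm ?powR_ge0//.
  by have := xis i; rewrite unlock => /le_lt_trans; apply; rewrite ltry.
have ixi i : P.-integrable setT (EFin \o xi i).
  have i1 : P.-integrable setT (EFin \o (fun w => 1 + `|xi i w| `^ s)).
    apply: integrable_EFinD => //.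
    exact/bounded_measurable_integrable/bounded_measurable_cst.
  apply: (le_integrable measurableT _ _ i1); first exact/measurable_EFinP.
  move=> w _ /=; rewrite lee_fin; apply: le_trans (ler_norm _).
  have [h|/ltW h] := leP `|xi i w| 1; first by rewrite ler_wpDr ?powR_ge0.
  by rewrite ler_wpDl// le1r_powR//; move: hs; lra.
have xi0' i : (\int[P]_w xi i w)%R = 0.
  by have := xi0 i; rewrite unlock /Rintegral => ->.
have irest i : P.-integrable setT
    (EFin \o (fun w => tail_rest s L alpha0 n (xi i w))).
  exact: integrable_EFinZ.
have restB i : (\int[P]_w tail_rest s L alpha0 n (xi i w))%R <=
    tail_const s L alpha0 * M `^ (- s) * B.
  rewrite RintegralZl// ler_wpM2l ?mulr_ge0 ?powR_ge0//.
  rewrite -lee_fin fineK; last by apply: integrable_fin_num => //; exact: ipow.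
  by have := xis i; rewrite unlock.
have sqdistE h : sqdist x h f = n%:R^-1 * \sum_i (f (x i) - h (x i)) ^+ 2.
  by congr (_ * _); apply: eq_bigr => i _; rewrite -sqrrN opprB.
have bsq : bounded_measurable (fun l => n%:R^-1 * \sum_i g l i ^+ 2).
  by apply/bounded_measurableZ/bounded_measurable_sum => i; exact: bounded_measurableX.
have sqdist_p : (\int[p]_l (sqdist x (F l) f)%:E)%E =
    (n%:R^-1 * \sum_i (\int[p]_l (g l i ^+ 2))%R)%:E.
  under eq_integral do rewrite sqdistE.
  rewrite -[LHS]fineK; last first.
    by apply: integrable_fin_num => //; exact: bounded_measurable_integrable bsq.
  congr EFin; rewrite -[LHS]/(\int[p]_l (n%:R^-1 * \sum_i g l i ^+ 2))%R.
  rewrite Rintegral_bZ; last first.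
    by apply: bounded_measurable_sum => i; exact: bounded_measurableX.
  by rewrite Rintegral_bsum// => i; exact: bounded_measurableX.
rewrite sqdist_p.
have bn0 : 0 < beta / n.+1%:R by rewrite divr_gt0.
have [KLy|KLfin] := eqVneq (KL p pi) +oo%E.
  by rewrite KLy gt0_muley ?lte_fin// addey// addye// leey.
have KLlt : (KL p pi < +oo)%E by rewrite ltey.
have risk := posterior_mean_risk_le (pi := pi) n0 beta0 L0 mg gL indep sym ixi xi0'
  (tail_rest_ge0 s n L0 halpha0)
  (fun t _ => @tail_rest_large _ _ _ _ _ _ n0 hs L0 halpha0 beta_ge' t)
  (@tail_rest_outlier _ _ _ _ _ _ n0 hs L0 halpha0 beta_ge') irest restB (ltW thr_gt0) thrL KLlt.
rewrite unlock.
under eq_integral => w _.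
  rewrite (_ : sqdist _ _ _ = n%:R^-1 *
    \sum_i posterior_mean pi g beta [tuple xi j w | j < n] i ^+ 2); last first.
    rewrite sqdistE; congr (_ * _); apply: eq_bigr => i _.
    rewrite -sqrrN opprB (ewa_error x pi beta n0 mF FL) sqrrN /posterior_mean.
    rewrite (_ : tnth _ = fun j => xi j w)//.
    by apply/funext => j; rewrite tnth_mktuple.
  over.
apply: le_trans risk _.
rewrite -{2}(fineK (_ : KL p pi \is a fin_num)); last first.
  by rewrite fin_numElt KL_gtNy.
rewrite -EFinM -!EFinD lee_fin.
rewrite [X in X + _]addrC lerD2l.
by rewrite [leRHS]mulrDl mul1r mulrAC lerDl powR_ge0.
Qed.
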